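(* Assume GCH and property $( * )$: there exist an enumeration $\langle f_\alpha \mid \alpha<\aleph_{\omega+1}\rangle$ of all functions $f:\omega\to\aleph_\omega$, a stationary set $S\subseteq\aleph_{\omega+1}$ all of whose members have cofinality $\aleph_1$, for each $\beta\in S$ a cofinal subset $C_\beta\subseteq\beta$ of order type $\omega_1$, and a countable ordinal $\delta$, such that, writing $F_\alpha$ for the range of $f_\alpha$ and $E_\beta=\bigcup_{\alpha\in C_\beta}F_\alpha$: (1) for every $\beta\in S$ and every $D\subseteq C_\beta$ cofinal in $C_\beta$, $\bigcup_{\alpha\in D}F_\alpha$ has order type $\delta$; (2) for $\beta\neq\gamma$ in $S$, $E_\beta\cap E_\gamma$ has order type less than $\delta$; (3) $\delta$ is indecomposable (not a finite sum of smaller ordinals). Then there is a torsion-free abelian group $G$ of cardinality $\aleph_{\omega+1}$ which does not admit an $\aleph_0$-prebalanced chain.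
   Context: All groups are abelian. For an element $h$ of a torsion-free group $H$, $\mathbf{t}(h)$ denotes its type in $H$ (the equivalence class of its characteristic/height sequence with respect to the primes, modulo finitely many finite differences), with the usual ordering $\le$ and union (supremum) $\cup$ of types. A pure subgroup $G$ of a torsion-free group $H$ is $\aleph_0$-prebalanced in $H$ if for every $h\in H\setminus G$ there are countably many elements $g_0,g_1,\ldots\in G$ such that for every $g\in G$ there are natural numbers $n,l$ with $\mathbf{t}(h-g)\le \mathbf{t}(lh-g_0)\cup\cdots\cup\mathbf{t}(lh-g_n)$ (types computed in $H$). A torsion-free group $G$ admits an $\aleph_0$-prebalanced chain if $G$ is the union of a continuous increasing chain of pure subgroups, each $\aleph_0$-prebalanced in $G$, such that at successor stages the quotients of consecutive members have rank $1$.
   Formalization: The chain is required to start at the zero subgroup and the natural number l to be positive; otherwise the one-member chain consisting of G alone (or the choice l = 0, g_0 = 0) would make every torsion-free group admit such a chain. *)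

(* Defs.v *)
From mathcomp Require Import all_boot all_order all_algebra.
From mathcomp Require Import boolp classical_sets functions cardinality wochoice.

Set Implicit Arguments.
Unset Strict Implicit.
Unset Printing Implicit Defensive.

Import Order.TTheory GRing.Theory.
Local Open Scope classical_set_scope.
Local Open Scope card_scope.

(** * Cardinals *)

(* All cardinals below that of [A] are represented by subsets of [A], so the
   alephs can be characterised inside [A]. *)
Definition card_succ (T : Type) (A B : set T) : Prop :=
  [/\ A #<= B, ~ (B #<= A)
    & forall C : set T, C `<=` B -> C #<= A \/ B #<= C].

Fixpoint is_aleph (n : nat) (T : Type) (A : set T) : Prop :=
  if n is m.+1
  then exists B : set T, [/\ B `<=` A, is_aleph m B & card_succ B A]
  else A #= [set: nat].

(* The supremum of the [aleph_n]. *)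
Definition is_aleph_omega (T : Type) (A : set T) : Prop :=
  let above_alephs (C : set T) :=
    forall n, exists2 B : set T, B `<=` C & is_aleph n B in
  above_alephs A /\
  forall C : set T, C `<=` A -> above_alephs C -> A #<= C.

Definition is_aleph_omega1 (T : Type) (A : set T) : Prop :=
  exists B : set T, [/\ B `<=` A, is_aleph_omega B & card_succ B A].

Definition GCH : Prop :=
  forall T U : Type, infinite_set [set: T] ->
    [set: T] #<= [set: U] -> [set: U] #<= [set: set T] ->
    [set: U] #<= [set: T] \/ [set: set T] #<= [set: U].

(** * Ordinals *)

(* Ordinals are handled inside a well-ordered type [W]: an element [a] stands
   for the ordinal [seg a], the set of its predecessors. *)
Section Ordinals.
Context {d : Order.disp_t} {W : orderType d}.
Implicit Types (a b : W) (X C D : set W).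
Local Open Scope order_scope.

Definition seg a : set W := [set x | x < a].

Definition has_order_type X a : Prop :=
  exists phi : W -> W, set_bij X (seg a) phi /\
    forall x y, X x -> X y -> (phi x <= phi y) = (x <= y).

Definition has_order_type_below X a : Prop :=
  exists2 b, b < a & has_order_type X b.

Definition initial_ordinal a : Prop :=
  forall b, b < a -> ~ (seg a #<= seg b).

Definition is_omega1 a : Prop := is_aleph 1 (seg a) /\ initial_ordinal a.

Definition is_omega_omega a : Prop :=
  is_aleph_omega (seg a) /\ initial_ordinal a.

Definition cofinal_in D C : Prop :=
  D `<=` C /\ forall c, C c -> exists2 x, D x & c <= x.

Definition has_cofinality_aleph1 b : Prop :=
  exists X, [/\ cofinal_in X (seg b), is_aleph 1 X
    & forall Y, cofinal_in Y (seg b) -> X #<= Y].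

Definition club C : Prop :=
  (forall a, exists2 c, C c & a < c) /\
  (forall b, (exists a, a < b) ->
     (forall a, a < b -> exists c, [/\ C c, a < c & c < b]) -> C b).

Definition stationary (S : set W) : Prop :=
  forall C, club C -> S `&` C !=set0.

(* [sum_is s a] says that [a] is the ordinal sum of [s]; it rests on the fact
   that [b + c = a] iff [b <= a] and the interval [[b, a[] has order type [c]. *)
Fixpoint sum_is (s : seq W) (a : W) : Prop :=
  if s is b :: s' then
    exists2 c, sum_is s' c &
      b <= a /\ has_order_type [set x | b <= x /\ x < a] c
  else seg a = set0.

Definition indecomposable a : Prop :=
  forall s : seq W, (forall b, b \in s -> b < a) -> ~ sum_is s a.

End Ordinals.

(* [W] has the order type of the initial ordinal of cardinal [aleph_(omega+1)]. *)
Definition is_omega_omega1 (d : Order.disp_t) (W : orderType d) : Prop :=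
  [/\ well_order (<=%O : rel W), is_aleph_omega1 [set: W]
    & forall a : W, ~ ([set: W] #<= seg a)].

Definition property_star : Prop :=
  exists (d : Order.disp_t) (W : orderType d),
  is_omega_omega1 W /\
  exists (w : W) (f : W -> nat -> W) (S : set W) (C : W -> set W) (delta : W),
  let F a := range (f a) in
  let E b := \bigcup_(a in C b) F a in
  is_omega_omega w /\
  ((forall a n, seg w (f a n)) /\
   (forall g : nat -> W, (forall n, seg w (g n)) -> exists a, f a = g)) /\
  (stationary S /\ forall b, S b -> has_cofinality_aleph1 b) /\
  (forall b, S b -> cofinal_in (C b) (seg b) /\
     exists2 w1, is_omega1 w1 & has_order_type (C b) w1) /\
  countable (seg delta) /\
  (forall b D, S b -> cofinal_in D (C b) ->
     has_order_type (\bigcup_(a in D) F a) delta) /\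
  (forall b c, S b -> S c -> b <> c ->
     has_order_type_below (E b `&` E c) delta) /\
  indecomposable delta.

(** * Types *)

Definition prime_number : Type := {p : nat | prime p}.

(* Heights are natural numbers or infinity, the latter encoded by [None]. *)
Definition height_le (a b : option nat) : bool :=
  match a, b with
  | _, None => true
  | None, Some _ => false
  | Some m, Some n => (m <= n)%N
  end.

Definition height_max (a b : option nat) : option nat :=
  if height_le a b then b else a.

Definition characteristic : Type := prime_number -> option nat.

Definition char_equiv (c e : characteristic) : Prop :=
  finite_set [set p | c p <> e p] /\
  forall p, c p <> e p -> c p <> None /\ e p <> None.

(* A type is an equivalence class of characteristics. *)
Definition type_le (s t : set characteristic) : Prop :=
  exists c e, [/\ s c, t e & forall p, height_le (c p) (e p)].

Definition type_cup (s t : set characteristic) : set characteristic :=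
  [set u | exists c e,
     [/\ s c, t e & char_equiv u (fun p => height_max (c p) (e p))]].

Fixpoint type_bigcup (t : nat -> set characteristic) (n : nat) :
    set characteristic :=
  if n is m.+1 then type_cup (type_bigcup t m) (t n) else t 0%N.

(** * Abelian groups *)

Section Groups.
Context {G : zmodType}.
Implicit Types (A B : set G) (x y g h : G).
Local Open Scope ring_scope.

Definition ndivides (n : nat) x : Prop := exists y, x = y *+ n.

(* The largest [k] such that [p ^ k] divides [h], found as the least [k] such
   that [p ^ k.+1] does not; infinite if there is none. *)
Definition height h (p : prime_number) : option nat :=
  if pselect (exists k, `[< ~ ndivides (val p ^ k.+1) h >]) is left ex
  then Some (ex_minn ex) else None.

Definition type_of h : set characteristic :=
  [set c | char_equiv c (height h)].

Definition torsion_free : Prop :=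
  forall x (n : nat), (0 < n)%N -> x *+ n = 0 -> x = 0.

Definition subgroup A : Prop := zmod_closed (mem A).

Definition pure_subgroup A : Prop :=
  subgroup A /\
  forall x (n : nat), (0 < n)%N -> A x -> ndivides n x ->
    exists2 y, A y & x = y *+ n.

(* [l] must be positive: for [l = 0] and [g 0 = 0] the right-hand side would be
   the largest type. *)
Definition aleph0_prebalanced A : Prop :=
  forall h, ~ A h ->
  exists g : nat -> G, (forall i, A (g i)) /\
  forall x, A x -> exists n l : nat, (0 < l)%N /\
    type_le (type_of (h - x))
            (type_bigcup (fun i => type_of (h *+ l - g i)) n).

Definition independent_mod A (s : seq G) : Prop :=
  forall c : 'I_(size s) -> int,
    A (\sum_(i < size s) s`_i *~ c i) -> forall i, c i = 0.

(* The quotient [B / A] has rank [n]: it has a maximal independent family with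
   [n] members. *)
Definition quotient_rank A B (n : nat) : Prop :=
  exists s : seq G, [/\ size s = n, forall x, x \in s -> B x,
    independent_mod A s & forall y, B y -> ~ independent_mod A (y :: s)].

End Groups.

(* As usual for continuous chains, the first member is [0]; otherwise the chain
   with the single member [G] would do for every [G]. *)
Definition admits_aleph0_prebalanced_chain (G : zmodType) : Prop :=
  exists (d : Order.disp_t) (I : orderType d) (A : I -> set G),
  let limit (j : I) := (exists i, (i < j)%O) /\
    forall i, (i < j)%O -> exists k, (i < k)%O /\ (k < j)%O in
  let successor (i j : I) := (i < j)%O /\
    forall k, ~ ((i < k)%O /\ (k < j)%O) in
  well_order (<=%O : rel I) /\
  \bigcup_i A i = [set: G] /\
  (forall i j, (i <= j)%O -> A i `<=` A j) /\
  (forall i, pure_subgroup (A i) /\ aleph0_prebalanced (A i)) /\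
  (forall i, (forall j, (i <= j)%O) -> A i = [set 0%R]) /\
  (forall j, limit j -> A j = \bigcup_(i in [set i | (i < j)%O]) A i) /\
  (forall i j, successor i j -> quotient_rank (A i) (A j) 1).

(* Main.v *)
From HB Require Import structures.
Require Import Defs.
From mathcomp Require Import all_boot all_order all_algebra.
From mathcomp Require Import boolp classical_sets functions cardinality wochoice.
From mathcomp Require Import fsbigop ring.

(** Let [X] be the set of all functions from the primes to [aleph_omega], and let
    [G] be the subgroup of the rational vector space on [X] in which [u - u'] is
    divisible by all powers of [p] whenever [u p = u' p]. Enumerate [X] in type
    [aleph_(omega+1)] and let [G_b] consist of the elements supported below [b].

    If [G] has an [aleph0]-prebalanced chain, then every subgroup closed under
    the countably many witnesses attached to each of its elements is
    [aleph0]-prebalanced; hence so is [G_b] for a club of [b], and thus for some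
    [b] in [S]. For that [b] we may assume by (2), after shrinking the club, that
    [E_b] meets each [F_a], [a < b], in order type less than [delta]. Let [u] in
    [X] enumerate [E_b]. For [a] in [C_b] some [z_a] in [G_b] takes values in
    [F_a] and agrees with [u] wherever [u] lies in [F_a], so that the type of
    [u - z_a] is infinite at the primes that [u] sends into [F_a]. For [g] in
    [G_b], the type of [l u - g] is infinite only at primes sent into finitely
    many of the sets [F_c], [c < b]. One and the same finite union of the latter
    must therefore serve for cofinally many [a] in [C_b]; as [delta] is
    indecomposable, this union meets [E_b] in order type less than [delta],
    contradicting (1). *)

Set Implicit Arguments.
Unset Strict Implicit.
Unset Printing Implicit Defensive.

Import Order.TTheory GRing.Theory Num.Theory.
Local Open Scope classical_set_scope.
Local Open Scope card_scope.

(** * Embeddings of well-ordered sets *)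

Section WellOrder.
Context {d : Order.disp_t} {W : orderType d}.
Hypothesis Wwo : well_order (<=%O : rel W).
Local Open Scope order_scope.

Lemma wo_min (P : W -> Prop) : (exists x, P x) ->
  exists x, P x /\ forall y, P y -> x <= y.
Proof.
move=> [x Px]; have [|z [[Az lbz] _]] := Wwo (A := fun x => `[< P x >]).
  by exists x; apply/asboolP.
exists z; split; first exact/asboolP.
by move=> y Py; apply: lbz; apply/asboolP.
Qed.

Lemma wo_ind (P : W -> Prop) :
  (forall x, (forall y, y < x -> P y) -> P x) -> forall x, P x.
Proof.
move=> IH x; apply: contrapT => nPx.
have [|y [nPy miny]] := @wo_min (fun x => ~ P x); first by exists x.
apply: nPy; apply: IH => z zy; apply: contrapT => /miny.
by rewrite leNgt zy.
Qed.

Lemma wo_wf : well_founded (fun x y : W => x < y).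
Proof. by apply: wo_ind => x IH; constructor. Qed.

(** Between subsets of a well-ordered type this says that the order type of [X] is at most that of
    [Y]. *)
Definition emb (X Y : set W) := exists f : W -> W,
  (forall x, X x -> Y (f x)) /\
  (forall x y, X x -> X y -> x < y -> f x < f y).

Lemma emb_trans X Y Z : emb X Y -> emb Y Z -> emb X Z.
Proof.
move=> [f [fXY fi]] [g [gYZ gi]]; exists (g \o f); split=> [x Xx|x y Xx Xy xy] /=.
  exact/gYZ/fXY.
by apply: gi; [exact: fXY|exact: fXY|exact: fi].
Qed.

Lemma emb_sub X Y : X `<=` Y -> emb X Y.
Proof. by move=> XY; exists id; split=> // x /XY. Qed.

Lemma emb_order_type X a : has_order_type X a -> emb X (seg a) /\ emb (seg a) X.
Proof.
move=> [phi [[fphi iphi sphi] mphi]]; split.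
  exists phi; split=> [|x y Xx Xy]; first exact: fphi.
  by rewrite !ltNge mphi.
have /boolp.choice[g gP] : forall y, exists x, seg a y -> X x /\ phi x = y.
  move=> y; have [/sphi[x Xx <-]|nay] := pselect (seg a y); first by exists x.
  by exists y.
exists g; split=> [y /gP[]//|x y /gP[Xx ex] /gP[Xy ey]].
by rewrite -{1}ex -{1}ey !ltNge mphi.
Qed.

(** An increasing map from [seg a] to itself never moves a point down, so it cannot send [b] below
    [b]. *)
Lemma emb_segN a b : b < a -> ~ emb (seg a) (seg b).
Proof.
move=> ba [f [fab fi]]; have fge x : seg a x -> x <= f x.
  elim/wo_ind: x => x IH xa; rewrite leNgt; apply/negP => fx.
  have fxa : seg a (f x) by apply: lt_trans fx _.
  have := IH _ fx fxa; rewrite leNgt => /negP; apply; exact: fi.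
by have /fab := ba; rewrite /seg/= ltNge fge.
Qed.

(** [Phi x] may consult its argument only below [x]; [t0] is a filler for the values not yet
    defined. *)
Lemma wo_rec (T : Type) (t0 : T) (Phi : W -> (W -> T) -> T) :
  (forall x g h, (forall y, y < x -> g y = h y) -> Phi x g = Phi x h) ->
  exists e, forall x, e x = Phi x e.
Proof.
move=> loc; pose F x (rec : forall y, y < x -> T) :=
  Phi x (fun y => if pselect (y < x) is left yx then rec y yx else t0).
exists (Fix wo_wf (fun=> T) F) => x; rewrite Fix_eq; last first.
  move=> y g h gh; apply: loc => z zy; case: pselect => // yx; exact: gh.
by apply: loc => y yx; case: pselect.
Qed.

(* Enumerating [X] in increasing order either reaches stage [a] or exhausts
   [X] before it. *)
Lemma order_type_total X a :
  emb (seg a) X \/ has_order_type_below X a.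
Proof.
pose next x (g : W -> W) : set W := [set z | X z /\ forall y, y < x -> g y < z].
have [e eE] : exists e, forall x,
    e x = xget a [set z | next x e z /\ forall z', next x e z' -> z <= z'].
  apply: (@wo_rec W a (fun x e =>
    xget a [set z | next x e z /\ forall z', next x e z' -> z <= z'])).
  move=> x g h gh; suff -> : next x g = next x h by [].
  apply/seteqP; split=> z [Xz zP]; split=> // y yx.
    by rewrite -gh//; exact: zP.
  by rewrite gh//; exact: zP.
have eP x : next x e !=set0 ->
    next x e (e x) /\ forall z', next x e z' -> e x <= z'.
  move=> /wo_min[z zP].
  have /(xgetPex a) : exists z, next x e z /\ forall z', next x e z' -> z <= z'.
    by exists z.
  by rewrite -eE.
have [all|] := pselect (forall x, x < a -> next x e !=set0).
  left; exists e; split=> [x xa|x y xa ya xy].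
    by have [[]] := eP _ (all x xa).
  by have [[_ +] _] := eP _ (all y ya); apply.
move=> /existsNP[x0 /not_implyP[x0a nx0]]; right.
(* The first stage [b] at which nothing of [X] is left is its order type. *)
have [b [[ba nb] minb]] : exists b, (b < a /\ ~ (next b e !=set0)) /\
    forall y, (y < a /\ ~ (next y e !=set0)) -> b <= y.
  by apply: wo_min; exists x0.
have ne x : x < b -> next x e !=set0.
  move=> xb; apply: contrapT => nx.
  by have := minb x (conj (lt_trans xb ba) nx); rewrite leNgt xb.
have einc x y : x < y -> y < b -> e x < e y.
  by move=> xy yb; have [[_ +] _] := eP _ (ne y yb); apply.
have eX x : x < b -> X (e x) by move=> xb; have [[]] := eP _ (ne x xb).
have surj z : X z -> exists2 y, y < b & e y = z.
  move=> Xz; have [y [[yb zy] miny]] : exists y, (y < b /\ z <= e y) /\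
      forall y', y' < b /\ z <= e y' -> y <= y'.
    apply: wo_min; apply: contrapT => /forallNP none; apply: nb.
    exists z; split=> // y yb; rewrite ltNge; apply/negP => zy.
    exact: (none y).
  exists y => //; apply/eqP; rewrite eq_le zy andbT.
  have [_ +] := eP _ (ne y yb); apply; split=> // y' y'y.
  rewrite ltNge; apply/negP => zy'.
  by have := miny y' (conj (lt_trans y'y yb) zy'); rewrite leNgt y'y.
have eqe x y : x < b -> y < b -> (x <= y) = (e x <= e y).
  move=> xb yb; have [xy|yx|->] := ltgtP x y; last by rewrite lexx.
    by rewrite ltW// einc.
  by rewrite leNgt einc.
have /boolp.choice[phi phiP] : forall z, exists y, X z -> y < b /\ e y = z.
  move=> z; have [/surj[y yb <-]|nz] := pselect (X z); first by exists y.
  by exists z.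
exists b => //; exists phi; split; first split.
- by move=> z /phiP[].
- move=> z z' /set_mem/phiP[_ ez] /set_mem/phiP[_ ez'] phizz'.
  by rewrite -ez phizz'.
- move=> y yb; exists (e y); first exact: eX.
  have [pb pe] := phiP _ (eX y yb); apply/eqP.
  by rewrite eq_le (eqe _ _ pb yb) (eqe _ _ yb pb) pe lexx.
- by move=> x y /phiP[xb ex] /phiP[yb ey]; rewrite eqe// ex ey.
Qed.

(** * Sets of small order type and indecomposable ordinals *)

Definition small a (X : set W) := exists2 b, b < a & emb X (seg b).

Lemma small_sub a X Y : X `<=` Y -> small a Y -> small a X.
Proof.
by move=> XY [b ba Yb]; exists b => //; apply: emb_trans Yb; exact: emb_sub.
Qed.

Lemma small_emb a X Y : emb X Y -> small a Y -> small a X.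
Proof. by move=> XY [b ba Yb]; exists b => //; exact: emb_trans Yb. Qed.

Lemma smallPn a X : ~ small a X -> emb (seg a) X.
Proof.
move=> nX; have [//|[b ba /emb_order_type[Xb _]]] := order_type_total X a.
by exfalso; apply: nX; exists b.
Qed.

Lemma order_type_smallN a X : has_order_type X a -> ~ small a X.
Proof.
move=> /emb_order_type[_ aX] [b ba Xb].
by apply: (emb_segN ba); exact: emb_trans Xb.
Qed.

Lemma small_below a X : has_order_type_below X a -> small a X.
Proof. by move=> [b ba /emb_order_type[Xb _]]; exists b. Qed.

Definition indecomposable_tail a :=
  forall b, b < a -> ~ small a [set x | b <= x /\ x < a].

(** A tail of type [e < a] starting at [b < a] would write [a] as the sum of [b] and [e]. *)
Lemma indecomposableP a : indecomposable a -> indecomposable_tail a.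
Proof.
move=> ia b ba [c ca tc].
(* [o] is the ordinal zero, the value of the empty sum that ends [sum_is]. *)
have [o [_ omin]] : exists o : W, True /\ forall y, True -> o <= y.
  by apply: wo_min; exists a.
have oP : seg o = set0.
  by apply/seteqP; split=> // x; rewrite /seg/= ltNge omin.
have [/emb_trans/(_ tc) /(emb_segN ca)//|] := order_type_total
  [set x | b <= x /\ x < a] a.
move=> [e ea et]; apply: (ia [:: b; e]).
  by move=> x; rewrite !inE => /orP[] /eqP->.
exists e; last by split=> //; exact: ltW.
exists o => //; split=> //.
exists id; split; first split.
- by move=> x [ex xe]; move: ex; rewrite leNgt xe.
- by move=> x y /set_mem[ex xe]; move: ex; rewrite leNgt xe.
- by move=> y; rewrite oP.
- by move=> x y [ex xe]; move: ex; rewrite leNgt xe.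
Qed.

(* Take a counterexample with the type [a] of [A], then the type [b] of [B],
   least possible. Tails of [A `|` B] are again counterexamples, hence [b] is
   indecomposable and both sets are cofinal in the union; so the proper initial
   segments of [A `|` B] are small for [b], by induction, and [A `|` B] embeds
   in [b]. *)
Lemma small_setU t A B : indecomposable_tail t ->
  small t A -> small t B -> small t (A `|` B).
Proof.
elim/wo_ind: t A B => t IHt A0 B0 it [a0 a0t A0a] [b0 b0t B0b].
apply: contrapT => nAB0.
pose bad a b A B := [/\ a < t, b < t, emb A (seg a), emb B (seg b) &
  ~ small t (A `|` B)].
have [a [[b1 [A1 [B1 bad1]]] mina]] : exists a,
    (exists b A B, bad a b A B) /\
    forall a', (exists b A B, bad a' b A B) -> a <= a'.
  by apply: wo_min; exists a0, b0, A0, B0.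
have [b [[A2 [B2 [at_ bt A2a B2b nAB2]]] minb]] : exists b,
    (exists A B, bad a b A B) /\
    forall b', (exists A B, bad a b' A B) -> b <= b'.
  by apply: wo_min; exists b1, A1, B1.
have ab : a <= b.
  by apply: mina; exists a, B2, A2; split; rewrite 1?setUC.
pose low (X : set W) z := [set x | X x /\ x < z].
pose high (X : set W) z := [set x | X x /\ z <= x].
have lowX X z : low X z `<=` X by move=> x [].
have highX X z : high X z `<=` X by move=> x [].
(* Cutting both sets at the least [z] whose predecessors are not small makes every proper initial
   segment of the union small. *)
have [A [B [Aa Bb nAB lowS]]] : exists A B, [/\ emb A (seg a), emb B (seg b),
    ~ small t (A `|` B) & forall z, (A `|` B) z -> small t (low (A `|` B) z)].
  have [|] := pselect (exists z, ~ small t (low (A2 `|` B2) z)); last first.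
    move=> /forallNP ns; exists A2, B2; split=> // z _; exact: contrapT.
  move=> /wo_min[z [nz minz]]; exists (low A2 z), (low B2 z).
  have lowU : low A2 z `|` low B2 z = low (A2 `|` B2) z.
    apply/seteqP; split=> x; first by move=> [] [Xx xz]; split=> //; [left|right].
    by move=> [[]]; [left|right].
  rewrite lowU; split=> //.
  - exact: emb_trans (emb_sub (lowX _ _)) A2a.
  - exact: emb_trans (emb_sub (lowX _ _)) B2b.
  - by move: nz; rewrite -lowU.
  move=> y [_ yz]; apply: contrapT => ny.
  have /minz : ~ small t (low (A2 `|` B2) y).
    by apply: contra_not ny; apply: small_sub => x [[ABx _] xy]; split.
  by rewrite leNgt yz.
(* The union contains a copy of [t]. Either it reaches [z], and then a tail of [t] would be small,
   or it stays in the small part below [z]. *)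
have tailS z : (A `|` B) z -> ~ small t (high A z `|` high B z).
  move=> /lowS[c ct lc] hs; have [e [eAB einc]] := smallPn nAB.
  have [|/forallNP none] := pselect (exists x, x < t /\ z <= e x).
    move=> /wo_min[x [[xt zx] _]]; apply: (it x xt); apply: small_emb hs.
    exists e; split=> [y [xy yt]|y y' [_ yt] [_ y't]]; last exact: einc.
    have zy : z <= e y.
      apply: le_trans zx _; move: xy; rewrite le_eqVlt => /predU1P[->//|xy].
      by apply/ltW; exact: einc.
    by have [] := eAB y yt; [left|right].
  apply: (emb_segN ct); apply: emb_trans lc; exists e; split=> // x xt.
  by split; [exact: eAB|rewrite ltNge; apply/negP => zx; exact: (none x)].
have cofA z : (A `|` B) z -> exists2 x, A x & z <= x.
  move=> ABz; apply: contrapT => none.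
  apply: (tailS z ABz); apply: (@small_sub _ _ B).
    by move=> x [[Ax zx]|[]//]; exfalso; apply: none; exists x.
  by exists b.
have cofB z : (A `|` B) z -> exists2 x, B x & z <= x.
  move=> ABz; apply: contrapT => none.
  apply: (tailS z ABz); apply: (@small_sub _ _ A).
    by move=> x [[]//|[Bx zx]]; exfalso; apply: none; exists x.
  by exists a.
have ib : indecomposable_tail b.
  move=> c cb [c' c'b tc']; have [phi [phib phii]] := Bb.
  have [[z [Bz cz]]|/forallNP none] := pselect (exists z, B z /\ c <= phi z).
    suff : b <= c' by rewrite leNgt c'b.
    apply: minb; exists (high A z), (high B z); split=> //.
    - exact: lt_trans c'b bt.
    - exact: emb_trans (emb_sub (highX _ _)) Aa.
    - apply: emb_trans tc'; exists phi.
      split=> [x [Bx zx]|x y [Bx _] [By _]]; last exact: phii.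
      split; last exact: phib.
      apply: le_trans cz _; move: zx; rewrite le_eqVlt => /predU1P[->//|zx].
      by apply/ltW; exact: phii.
    - by apply: tailS; right.
  suff : b <= c by rewrite leNgt cb.
  apply: minb; exists A, B; split=> //; first exact: lt_trans cb bt.
  exists phi; split=> // x Bx; rewrite /seg/= ltNge; apply/negP => cx.
  exact: (none x).
(* Points of both sets at or above [z] bound the types of the two low parts below [b], so the
   induction hypothesis at [b] applies. *)
have low_small z : (A `|` B) z -> small b (low (A `|` B) z).
  move=> ABz; apply: (@small_sub _ _ (low A z `|` low B z)).
    by move=> x [[]]; [left|right].
  apply: IHt => //.
    have [x Ax zx] := cofA z ABz; have [phi [phia phii]] := Aa.
    exists (phi x); first exact: lt_le_trans (phia x Ax) ab.
    exists phi; split=> [y [Ay yz]|y y' [Ay _] [Ay' _]]; last exact: phii.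
    by apply: phii => //; exact: lt_le_trans zx.
  have [x Bx zx] := cofB z ABz; have [phi [phib phii]] := Bb.
  exists (phi x); first exact: phib.
  exists phi; split=> [y [By yz]|y y' [By _] [By' _]]; last exact: phii.
  by apply: phii => //; exact: lt_le_trans zx.
(* The first [b] members of a copy of [t] all lie below [e b], hence in a set of type less than
   [b]. *)
have [e [eAB einc]] := smallPn nAB.
have [c cb ec] := low_small _ (eAB b bt).
apply: (emb_segN cb); apply: emb_trans ec; exists e.
have bt' x : seg b x -> seg t x by move=> xb; exact: lt_trans bt.
split=> [x xb|x y /bt' xb /bt' yb]; last exact: einc.
by split; [exact/eAB/bt'|apply: einc => //; exact: bt'].
Qed.

End WellOrder.

(** * Alephs under GCH *)

(** Stated for types, so that maps compose without membership conditions; subsets take part as the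
    types of their members. *)
Definition injects (T U : Type) : Prop := exists f : T -> U, injective f.

Lemma injects_refl T : injects T T.
Proof. by exists id. Qed.

Lemma injects_trans T U V : injects T U -> injects U V -> injects T V.
Proof. by move=> [f fi] [g gi]; exists (g \o f); exact: inj_comp. Qed.

Lemma surj_injects T U (f : T -> U) : (forall y, exists x, f x = y) -> injects U T.
Proof. by move=> /boolp.choice[g gK]; exists g; exact: can_inj gK. Qed.

Lemma card_le_injects T U (A : set T) (B : set U) : A #<= B <-> injects A B.
Proof.
split=> [/card_leP[f]|[f fi]].
  by exists f => x y fxy; apply: (inj (f := f)); rewrite ?inE.
apply/card_leP; suff : $|{injfun [set: A] >-> [set: B]}| by [].
by apply/injfunPex; exists f => // x y _ _; exact: fi.
Qed.

Lemma setT_injects T : injects T [set: T] /\ injects [set: T] T.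
Proof.
split; first by exists (fun x => SigSub (mem_setT x)) => x y [].
by exists val; exact: val_inj.
Qed.

Lemma card_leT_injects T U : [set: T] #<= [set: U] <-> injects T U.
Proof.
rewrite card_le_injects; have [T1 T2] := setT_injects T.
have [U1 U2] := setT_injects U; split=> TU.
  exact: injects_trans T1 (injects_trans TU U2).
exact: injects_trans T2 (injects_trans TU U1).
Qed.

Lemma sub_injects T (A B : set T) : A `<=` B -> injects A B.
Proof. by move=> /subset_card_le/card_le_injects. Qed.

Lemma injects_range T U (f : T -> U) : injective f ->
  injects T (range f) /\ injects (range f) T.
Proof.
move=> fi; split.
  have fr x : f x \in range f by apply/mem_set; exists x.
  by exists (fun x => SigSub (fr x)) => x y [] /fi.
apply/(injects_trans _ (setT_injects T).2)/card_le_injects.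
exact: card_image_le.
Qed.

(** A maximal partial bijection, given by Zorn's lemma, is total on one side; otherwise a pair of
    missed points would extend it. *)
Lemma injects_total T U : injects T U \/ injects U T.
Proof.
pose P (R : set (T * U)) := forall x y x' y', R (x, y) -> R (x', y') ->
  x = x' <-> y = y'.
have [F FP Ftot|R [PR Rmax]] := @Zorn_bigcup (T * U)%type P.
  move=> x y x' y' [R FR Rxy] [R' FR' Rxy'].
  by have [RR'|R'R] := Ftot _ _ FR FR'; [apply: (FP _ FR')|apply: (FP _ FR)];
    [exact: RR'|exact: Rxy'|exact: Rxy|exact: R'R].
have [domT|/existsNP[x0 /forallNP nx0]] := pselect (forall x, exists y, R (x, y)).
  left; have [f fR] := boolp.choice domT.
  by exists f => x x' ff; apply/(PR _ _ _ _ (fR x) (fR x')).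
have [domU|/existsNP[y0 /forallNP ny0]] := pselect (forall y, exists x, R (x, y)).
  right; have [f fR] := boolp.choice domU.
  by exists f => y y' ff; apply/(PR _ _ _ _ (fR y) (fR y')).
exfalso; apply: (Rmax (R `|` [set (x0, y0)])); first split.
- by move=> ?; left.
- by move=> /(_ (x0, y0)) RR; apply: (nx0 y0); apply: RR; right.
move=> x y x' y' [Rxy|[-> ->]] [Rxy'|[-> ->]] //; first exact: PR Rxy Rxy'.
- split=> e; first by exfalso; apply: (nx0 y); rewrite -e.
  by exfalso; apply: (ny0 x); rewrite -e.
- split=> e; first by exfalso; apply: (nx0 y'); rewrite e.
  by exfalso; apply: (ny0 x'); rewrite e.
Qed.

Lemma cantor T : ~ injects (set T) T.
Proof.
move=> [f fi]; pose D := [set x | exists2 A : set T, f A = x & ~ A x].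
have [DfD|nD] := pselect (D (f D)); last by apply: (nD); exists D.
by have [A /fi AD] := DfD; rewrite AD.
Qed.

Lemma injects_set T U : injects T U -> injects (set T) (set U).
Proof.
move=> [f fi]; exists (fun A => f @` A) => A B /seteqP[AB BA].
apply/seteqP; split=> x Ax.
  by have [|y By /fi <-] := AB (f x); first by exists x.
by have [|y By /fi <-] := BA (f x); first by exists x.
Qed.

Lemma injects_prod T T' U U' :
  injects T U -> injects T' U' -> injects (T * T') (U * U').
Proof.
move=> [f fi] [g gi]; exists (fun x => (f x.1, g x.2)).
by move=> [x y] [x' y'] [/fi/= -> /gi/= ->].
Qed.

Lemma injects_count (T : countType) : injects T nat.
Proof. by exists pickle; exact: (pcan_inj pickleK). Qed.

(** Under GCH these iterated power sets represent the alephs of finite index. *)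
Fixpoint beth (n : nat) : Type := if n is m.+1 then set (beth m) else nat.

Lemma beth_S n : injects (beth n) (beth n.+1).
Proof. by exists (@set1 _) => x y /seteqP[+ _] => /(_ x erefl). Qed.

Lemma beth_le m n : (m <= n)%N -> injects (beth m) (beth n).
Proof.
elim: n => [|n IHn]; first by rewrite leqn0 => /eqP->; exact: injects_refl.
rewrite leq_eqVlt => /predU1P[->|]; first exact: injects_refl.
by rewrite ltnS => /IHn/injects_trans; apply; exact: beth_S.
Qed.

Lemma beth_point n : exists _ : beth n, True.
Proof. by have [f _] := beth_le (leq0n n); exists (f 0%N). Qed.

Lemma injects_set_prod T : injects (set T * set T) (set (bool * T)).
Proof.
exists (fun A => [set x | if x.1 then A.1 x.2 else A.2 x.2]).
move=> [A B] [A' B'] /seteqP[AB BA].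
by congr (_, _); apply/seteqP; split=> x xP;
  [exact: (AB (true, x))|exact: (BA (true, x))
  |exact: (AB (false, x))|exact: (BA (false, x))].
Qed.

Lemma beth_double n : injects (bool * beth n) (beth n).
Proof.
elim: n => [|n IHn] /=; first exact: injects_count.
apply: injects_trans (injects_set IHn).
apply: injects_trans (injects_set_prod _).
apply: injects_prod; last exact: injects_refl.
have [x _] := beth_point n.
exists (fun b : bool => [set y : beth n | b]) => -[] [] // /seteqP[h h'].
  by have := h x isT.
by have := h' x isT.
Qed.

(** A product of two power sets of [T] embeds in the power set of [bool * T], so squaring reduces to
    doubling one level lower. *)
Lemma beth_square n : injects (beth n * beth n) (beth n).
Proof.
case: n => [|n] /=; first exact: injects_count.
exact: injects_trans (injects_set_prod _) (injects_set (beth_double n)).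
Qed.

Section Alephs.
Hypothesis gch : GCH.

Lemma gch_beth n U : injects (beth n) U -> injects U (beth n.+1) ->
  injects U (beth n) \/ injects (beth n.+1) U.
Proof.
move=> /card_leT_injects nU /card_leT_injects Un.
have ninf : infinite_set [set: beth n].
  by apply/infiniteP/card_leT_injects; exact: (beth_le (leq0n n)).
have [H|H] := gch ninf nU Un; last by right; exact/card_leT_injects.
by left; exact/card_leT_injects.
Qed.

(** By GCH nothing lies strictly between [beth n] and its power set, so a cardinal successor inside
    [A] has the size of the power set. *)
Lemma is_alephP n T (A : set T) :
  is_aleph n A <-> injects A (beth n) /\ injects (beth n) A.
Proof.
elim: n T A => [|n IHn] T A /=.
  have [N1 N2] := setT_injects nat.
  rewrite card_eq_le; split=> [/andP[]|[An nA]].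
    move=> /card_le_injects AN /card_le_injects NA.
    by split; [exact: injects_trans N2|exact: injects_trans N1 _].
  apply/andP; split; apply/card_le_injects; first exact: injects_trans N1.
  exact: injects_trans N2 _.
split=> [[B [BA /IHn[Bn nB] [/card_le_injects BA' nAB succ]]]|[An nA]].
  have nAn : ~ injects A (beth n).
    move=> An; apply: nAB; apply/card_le_injects; exact: injects_trans nB.
  have nA : injects (beth n) A by exact: injects_trans BA'.
  suff AS : injects A (beth n.+1).
    by split=> //; have [/nAn|] := gch_beth nA AS.
  have [//|[f fi]] := injects_total A (beth n.+1).
  pose C : set T := range (val \o f).
  have [nC Cn] := injects_range (inj_comp val_inj fi).
  have CA : C `<=` A by move=> _ [x _ <-] /=; exact: set_valP.
  have [/card_le_injects CB|/card_le_injects AC] := succ C CA.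
    exfalso; apply: (@cantor (beth n)).
    exact: injects_trans nC (injects_trans CB Bn).
  exact: injects_trans AC Cn.
have [f fi] : injects (beth n) A by apply: injects_trans nA; exact: beth_S.
have [nB Bn] := injects_range (inj_comp val_inj fi).
exists (range (val \o f)); split.
- by move=> _ [x _ <-] /=; exact: set_valP.
- exact/IHn.
split.
- by apply/card_le_injects; apply: injects_trans Bn _; exists f.
- move=> /card_le_injects AB; apply: (@cantor (beth n)).
  exact: injects_trans nA (injects_trans AB Bn).
move=> C /sub_injects CA.
have [nC|Cn] := injects_total (beth n) C.
  have [Cn|SC] := gch_beth nC (injects_trans CA An).
    by left; apply/card_le_injects; exact: injects_trans nB.
  by right; apply/card_le_injects; exact: injects_trans SC.
by left; apply/card_le_injects; exact: injects_trans nB.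
Qed.

Lemma is_aleph_omegaP T (A : set T) : is_aleph_omega A <->
  (forall n, injects (beth n) A) /\
  forall C : set T, C `<=` A -> (forall n, injects (beth n) C) -> injects A C.
Proof.
have above (C : set T) : (forall n, exists2 B : set T, B `<=` C & is_aleph n B)
    <-> forall n, injects (beth n) C.
  split=> + n => /(_ n) => [[B BC /is_alephP[_ nB]]|[f fi]].
    exact: injects_trans (sub_injects BC).
  have [nB Bn] := injects_range (inj_comp val_inj fi).
  exists (range (val \o f)); last exact/is_alephP.
  by move=> _ [x _ <-] /=; exact: set_valP.
split=> [[/above ? AC]|[? AC]]; split=> //; try exact/above.
  by move=> C CA /above nC; apply/card_le_injects; exact: AC.
by move=> C CA /above nC; apply/card_le_injects; exact: AC.
Qed.

End Alephs.

Lemma injects_image T U (f : T -> U) (A : set T) : injective f ->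
  injects A (f @` A) /\ injects (f @` A) A.
Proof.
move=> fi; have /card_eqPle[/card_le_injects ? /card_le_injects ?] :=
  inj_card_eq (A := A) (in2W fi).
by split.
Qed.

(** The definition speaks of subsets of the ambient type, so [f] carries the witness forward and [g]
    carries its competitors back. *)
Lemma is_aleph_omega1_injects (gch : GCH) T U :
  injects T U -> injects U T -> is_aleph_omega1 [set: T] ->
  is_aleph_omega1 [set: U].
Proof.
move=> [f fi] [g gi] [B [_ /(is_aleph_omegaP gch)[nB minB]]].
move=> [_ nTB succ]; have [BfB fBB] := injects_image B fi.
have [T1 T2] := setT_injects T; have [U1 U2] := setT_injects U.
exists (f @` B); split=> //.
  apply/(is_aleph_omegaP gch); split=> [n|C CfB nC].
    exact: injects_trans BfB.
  have fC : f @` (f @^-1` C) = C.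
    by apply/seteqP; split=> [_ [x Cx <-//]|x Cx]; have [y _ yx] := CfB x Cx;
      exists y => //=; rewrite yx.
  have [Cf fC'] := injects_image (f @^-1` C) fi.
  apply: injects_trans fBB (injects_trans (minB (f @^-1` C) _ _) _).
  - by move=> x /CfB[y By /fi <-].
  - by move=> n; apply: injects_trans fC'; rewrite fC.
  - by apply: injects_trans Cf _; rewrite fC; exact: injects_refl.
split.
- by apply/card_le_injects; exact: sub_injects.
- move=> /card_le_injects UB; apply/nTB/card_le_injects.
  apply: injects_trans fBB; apply: injects_trans UB.
  by apply: injects_trans U1; apply: injects_trans T2 _; exists f.
move=> C _; have [CgC gCC] := injects_image C gi.
have [/card_le_injects CB|/card_le_injects TC] := succ (g @` C) (fun _ _ => I).
  left; apply/card_le_injects; apply: injects_trans BfB.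
  exact: injects_trans CgC CB.
right; apply/card_le_injects; apply: injects_trans gCC.
by apply: injects_trans U2 (injects_trans _ TC); apply: injects_trans T1; exists g.
Qed.

(** * Comparison of types by divisibility *)

Section Divisibility.
Context {G : zmodType}.
Implicit Types (A B : set G) (a b c x y g h : G) (p : prime_number).
Local Open Scope ring_scope.

Lemma ndividesD n x y : ndivides n x -> ndivides n y -> ndivides n (x + y).
Proof. by move=> [u ->] [v ->]; exists (u + v); rewrite mulrnDl. Qed.

Lemma ndividesN n x : ndivides n x -> ndivides n (- x).
Proof. by move=> [u ->]; exists (- u); rewrite mulNrn. Qed.

Lemma ndividesB n x y : ndivides n x -> ndivides n y -> ndivides n (x - y).
Proof. by move=> nx /ndividesN; exact: ndividesD. Qed.

Lemma ndividesMn n x m : ndivides n x -> ndivides n (x *+ m).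
Proof. by move=> [u ->]; exists (u *+ m); rewrite mulrnAC. Qed.

Lemma ndivides0 n : ndivides n (0 : G).
Proof. by exists 0; rewrite mul0rn. Qed.

Lemma ndivides_dvd m n x : (m %| n)%N -> ndivides n x -> ndivides m x.
Proof. by move=> /dvdnP[k ->] [u ->]; exists (u *+ k); rewrite mulrnA. Qed.

Lemma ndivides_height h p k : ndivides (val p ^ k) h <->
  if height h p is Some m then (k <= m)%N else True.
Proof.
rewrite /height; case: pselect => [ex|/forallNP nex]; last first.
  split=> // _; apply: (@ndivides_dvd _ (val p ^ k.+1)).
    exact/dvdn_exp2l/leqnSn.
  by apply: contrapT => nk; apply: (nex k); apply/asboolP.
case: ex_minnP => m /asboolP nm minm; split=> [dk|].
  rewrite leqNgt; apply/negP => mk; apply: nm; apply: ndivides_dvd dk.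
  exact: dvdn_exp2l.
case: k => [_|k km]; first by exists h.
by apply: contrapT => nk; have := minm k; rewrite leqNgt km => /(_ (asboolT nk)).
Qed.

(* [cov B a] says that the type of [a] is at most the union of the types of the
   members of [B], when [B] is finite. *)
Definition cov B a := exists2 E : set prime_number, finite_set E &
  forall p, ~ E p \/ (forall k, ndivides (val p ^ k) a) ->
  exists2 b, B b &
    forall k, ndivides (val p ^ k) a -> ndivides (val p ^ k) b.

(** A maximum of heights is attained at one index. [E] collects the primes changed by [char_equiv];
    infinite values never change, which settles the primes with [u p = None]. *)
Lemma type_bigcup_height (b : nat -> G) n u :
  type_bigcup (fun i => type_of (b i)) n u ->
  exists2 E : set prime_number, finite_set E &
    forall p, ~ E p \/ u p = None ->
    exists2 i, (i <= n)%N & height_le (u p) (height (b i) p).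
Proof.
elim: n u => [|n IHn] u /=.
  move=> [Efin uN]; exists [set p | u p <> height (b 0%N) p] => // p up.
  exists 0%N => //; have [->|/eqP ub] := eqVneq (u p) (height (b 0%N) p).
    by case: height => /=.
  by have [unN _] := uN _ ub; case: up.
move=> [c [e [/IHn[E1 E1fin c1] [E2fin eN] [E3fin uN]]]].
exists (E1 `|` [set p | e p <> height (b n.+1) p]
  `|` [set p | u p <> height_max (c p) (e p)]).
  by rewrite !finite_setU.
move=> p up; have um : u p = height_max (c p) (e p).
  apply: contrapT => ue; have [unN _] := uN _ ue.
  by case: up => // nE; apply: nE; right.
rewrite um /height_max; case: ifP => ce.
  exists n.+1 => //; suff -> : e p = height (b n.+1) p by case: height => /=.
  apply: contrapT => ee; have [enN _] := eN _ ee; case: up => [nE|uNone].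
    by apply: nE; left; right.
  by apply: enN; rewrite -uNone um /height_max ce.
have [|i iln ci] := c1 p; last by exists i => //; exact: leqW.
case: up => [nE|]; first by left=> E1p; apply: nE; left; left.
by rewrite um /height_max ce; right.
Qed.

Lemma height_le_ndivides x y p k : height_le (height x p) (height y p) ->
  ndivides (val p ^ k) x -> ndivides (val p ^ k) y.
Proof.
rewrite !ndivides_height; case: (height x p); case: (height y p) => //= n m.
by move=> mn km; exact: leq_trans mn.
Qed.

Lemma type_le_cov a (b : nat -> G) n :
  type_le (type_of a) (type_bigcup (fun i => type_of (b i)) n) ->
  cov [set x | exists2 i, (i <= n)%N & x = b i] a.
Proof.
move=> [c [e [[cfin cN] /type_bigcup_height[E Efin eb] ce]]].
exists (E `|` [set p | c p <> height a p]); first by rewrite finite_setU.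
move=> p pa.
have pa' : ~ (E `|` [set p | c p <> height a p]) p \/ height a p = None.
  case: pa => [|dp]; [by left|right; case E1: (height a p) => [m|//]].
  by have := dp m.+1; rewrite ndivides_height E1 ltnn.
have cp : c p = height a p.
  apply: contrapT => ca; have [_ aN] := cN _ ca.
  by case: pa' => // nE; apply: nE; right.
have [|i iln ei] := eb p.
  case: pa' => [nE|aN]; first by left=> Ep; apply: nE; left.
  by right; move: (ce p); rewrite cp aN; case: (e p).
exists (b i); first by exists i.
move=> k; apply: height_le_ndivides; rewrite -cp.
by move: (ce p) ei; case: (c p); case: (e p); case: (height _ p) => //= m q r;
  exact: leq_trans.
Qed.

Lemma cov1 a : cov [set a] a.
Proof. by exists set0 => // p _; exists a. Qed.

Lemma covN B a : cov B (- a) -> cov B a.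
Proof.
move=> [E Efin EP]; exists E => // p pa.
have aN k : ndivides (val p ^ k) a <-> ndivides (val p ^ k) (- a).
  by split=> [/ndividesN//|/ndividesN]; rewrite opprK.
have [|b Bb bP] := EP p; first by case: pa => [|pa]; [left|right=> k; exact/aN].
by exists b => // k /aN; exact: bP.
Qed.

(* Types satisfy [t(a) = t(a) /\ (\/_b t(b)) = \/_b (t(a) /\ t(b))]; each
   [t(a) /\ t(b)] is below some [t(c)], which is covered in turn. *)
Lemma cov_trans (S B : set G) a : finite_set B -> cov B a ->
  (forall b, B b -> exists c C, [/\ finite_set C, cov C c,
    forall n, ndivides n a -> ndivides n b -> ndivides n c &
    forall x, C x -> exists2 y, S y & forall n, ndivides n a -> ndivides n b ->
      ndivides n x -> ndivides n y]) ->
  exists2 D, finite_set D /\ D `<=` S & cov D a.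
Proof.
move=> Bfin [E Efin EP] H; pose ok b c C := [/\ finite_set C, cov C c,
  forall n, ndivides n a -> ndivides n b -> ndivides n c &
  forall x, C x -> exists2 y, S y & forall n, ndivides n a -> ndivides n b ->
    ndivides n x -> ndivides n y].
have /boolp.choice[c cP] b : exists c, B b -> exists C, ok b c C.
  have [/H[c [C]]|nB] := pselect (B b); last by exists 0.
  by exists c => _; exists C.
have /boolp.choice[C CP] b : exists C, B b -> ok b (c b) C.
  have [/cP[C]|nB] := pselect (B b); last by exists set0.
  by exists C.
have /boolp.choice[F FP] b : exists F : set prime_number, B b ->
    finite_set F /\
    forall p, ~ F p \/ (forall k, ndivides (val p ^ k) (c b)) ->
    exists2 x, C b x &
      forall k, ndivides (val p ^ k) (c b) -> ndivides (val p ^ k) x.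
  have [/CP[_ [F Ffin FP] _ _]|nB] := pselect (B b); last by exists set0.
  by exists F.
have /boolp.choice[y yP] (bx : G * G) : exists y, B bx.1 -> C bx.1 bx.2 ->
    S y /\ forall n, ndivides n a -> ndivides n bx.1 -> ndivides n bx.2 ->
      ndivides n y.
  have [Bb|nB] := pselect (B bx.1); last by exists 0.
  have [Cx|nC] := pselect (C bx.1 bx.2); last by exists 0.
  by have [_ _ _ /(_ _ Cx)[z Sz zP]] := CP _ Bb; exists z.
exists (\bigcup_(b in B) (fun x => y (b, x)) @` C b).
  split; last by move=> _ [b Bb [x Cx <-]]; have [] := yP (b, x) Bb Cx.
  apply: bigcup_finite => // b Bb; apply: finite_image.
  by have [] := CP b Bb.
exists (E `|` \bigcup_(b in B) F b).
  rewrite finite_setU; split=> //; apply: bigcup_finite => // b Bb.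
  by have [] := FP b Bb.
move=> p pa; have [|b Bb ab] := EP p.
  by case: pa => [nE|]; [left=> Ep; apply: nE; left|right].
have [_ _ abc _] := CP b Bb; have [_ /(_ p)[|x Cx cx]] := FP b Bb.
  case: pa => [nE|da]; first by left=> Fp; apply: nE; right; exists b.
  by right=> k; apply: abc => //; exact: ab.
exists (y (b, x)); first by exists b => //; exists x.
move=> k ka; have [_] := yP (b, x) Bb Cx; apply => //=; first exact: ab.
by apply: cx; apply: abc => //; exact: ab.
Qed.

End Divisibility.

(** * Prebalanced chains *)

Section Chain.
Context {G : zmodType}.
Hypothesis tf : @torsion_free G.
Implicit Types (X Om A B : set G) (x y g h : G).
Local Open Scope ring_scope.

Lemma subgroup0 A : subgroup A -> A 0.
Proof. by move=> [A0 _]; exact: set_mem. Qed.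

Lemma subgroupB A x y : subgroup A -> A x -> A y -> A (x - y).
Proof. by move=> [_ AB] Ax Ay; apply/set_mem/AB; exact: mem_set. Qed.

Lemma subgroupN A x : subgroup A -> A x -> A (- x).
Proof.
by move=> sA Ax; rewrite -sub0r; apply: subgroupB => //; exact: subgroup0.
Qed.

Lemma subgroupD A x y : subgroup A -> A x -> A y -> A (x + y).
Proof.
move=> sA Ax Ay; rewrite -[y]opprK; apply: subgroupB => //.
exact: subgroupN.
Qed.

Lemma subgroupMn A x n : subgroup A -> A x -> A (x *+ n).
Proof.
move=> sA Ax; elim: n => [|n IHn]; first exact: subgroup0.
by rewrite mulrS; exact: subgroupD.
Qed.

Lemma subgroupMz A x (z : int) : subgroup A -> A x -> A (x *~ z).
Proof.
move=> sA Ax; case: z => n; first exact: subgroupMn.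
by apply: subgroupN => //; exact: subgroupMn.
Qed.

Lemma pure_subgroupMn A x n : pure_subgroup A -> (0 < n)%N -> A (x *+ n) -> A x.
Proof.
move=> [sA pA] n0 Ax; have [|y Ay xy] := pA _ n n0 Ax; first by exists x.
suff -> : x = y by [].
by apply/eqP; rewrite -subr_eq0; apply/eqP/(tf n0); rewrite mulrnBl xy subrr.
Qed.

Lemma pure_subgroupMz A x (z : int) : pure_subgroup A -> z != 0 ->
  A (x *~ z) -> A x.
Proof.
move=> pA; case: z => n z0; first by apply: pure_subgroupMn => //; rewrite lt0n.
move=> Ax; apply: (@pure_subgroupMn _ _ n.+1) => //.
by rewrite -[_ *+ _]opprK; apply: subgroupN => //; case: pA.
Qed.

(** Modulo [A] both [x] and [h] depend on one element [y]. Eliminating [y] relates them, and purity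
    keeps the coefficient of [h] nonzero because [x] is not in [A]. *)
Lemma quotient_rank1 A B x h : pure_subgroup A -> quotient_rank A B 1 ->
  B x -> ~ A x -> B h -> exists l (z : int), (0 < l)%N /\ A (h *+ l - x *~ z).
Proof.
move=> pA [[|y [|? ?]] [//= _ By indy maxy] Bx nAx Bh].
have sA : subgroup A by case: pA.
have dep u : B u -> exists c d : int, c != 0 /\ A (u *~ c + y *~ d).
  move=> /maxy /existsNP[c /not_implyP[/= Ac /existsNP[i ci]]].
  exists (c ord0), (c (lift ord0 ord0)).
  have Au : A (u *~ c ord0 + y *~ c (lift ord0 ord0)).
    by move: Ac; rewrite !big_ord_recl big_ord0 /= addr0.
  split=> //; apply/eqP => c0; apply: ci.
  have cy : c (lift ord0 ord0) = 0.
    apply: (indy (fun=> c (lift ord0 ord0)) _ ord0).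
    by rewrite big_ord_recl big_ord0 /= addr0; move: Au; rewrite c0 mulr0z add0r.
  have [->//|[j ->]] : i = ord0 \/ exists j, i = lift ord0 j.
    by case: (unliftP ord0 i) => [j ->|->]; [right; exists j|left].
  by rewrite (ord1 j).
have [c [d [c0 Axy]]] := dep x Bx; have [e [f [e0 Ahy]]] := dep h Bh.
have d0 : d != 0.
  apply/eqP => d0; apply: nAx; apply: (pure_subgroupMz pA c0).
  by move: Axy; rewrite d0 mulr0z addr0.
have A1 : A (h *~ (e * d) - x *~ (c * f)).
  have -> : h *~ (e * d) - x *~ (c * f) =
      (h *~ e + y *~ f) *~ d - (x *~ c + y *~ d) *~ f.
    rewrite !mulrzDl -!mulrzA opprD addrACA [f * d]mulrC subrr addr0.
    by [].
  by apply: subgroupB => //; exact: subgroupMz.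
have ed0 : e * d != 0 by rewrite mulf_neq0.
case: (e * d) ed0 A1 => n n0 A1; first by exists n, (c * f); rewrite lt0n.
exists n.+1, (- (c * f)); split=> //.
by move/(subgroupN sA): A1; rewrite opprB mulrNz opprK NegzE mulrNz opprK addrC.
Qed.

Definition shifts h Om : set G :=
  [set y | exists l g, [/\ (0 < l)%N, Om g & y = h *+ l - g]].

(* [Om] is a countable set witnessing that [X] is [aleph0]-prebalanced at [h],
   in a form uniform in the multiples of [h]. *)
Definition witnesses X h Om : Prop :=
  [/\ countable Om, Om `<=` X & forall l x, (0 < l)%N -> X x ->
    exists2 B, finite_set B /\ B `<=` shifts h Om & cov B (h *+ l - x)].

Lemma witnesses_mem X h : X h -> witnesses X h [set h].
Proof.
move=> Xh; split=> [||l x l0 Xx]; first exact: countable1.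
  by move=> _ ->.
exists [set 0]; last by exists set0 => // p _; exists 0 => // k _; exact: ndivides0.
by split=> // _ ->; exists 1%N, h; rewrite mulr1n subrr.
Qed.

(** [w] lists witnesses for the prebalancedness of [A] at [x], with types replaced by coverings. *)
Definition pred_member (A : set G) x (w : nat -> G) :=
  (forall k, A (w k)) /\ forall y, A y -> exists n l, (0 < l)%N /\
    cov [set u | exists2 i, (i <= n)%N & u = x *+ l - w i] (x - y).

Lemma finite_le_image (u : nat -> G) n :
  finite_set [set x | exists2 i, (i <= n)%N & x = u i].
Proof.
rewrite (_ : [set _ | _] = u @` `I_n.+1); first exact/finite_image/finite_II.
by apply/seteqP; split=> x [i]; rewrite /= ?ltnS => ? xi; exists i.
Qed.

(** For nonzero [x], [w x] lists witnesses at [x] in the chain member just before the first one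
    containing [x]. Closure under [w] suffices by induction on the first member containing [h]. *)
Lemma chain_witnesses : admits_aleph0_prebalanced_chain G ->
  exists w : G -> nat -> G, forall X, subgroup X ->
    (forall x k, X x -> X (w x k)) -> forall h, exists Om, witnesses X h Om.
Proof.
move=> [d [I [A [Iwo [cover [mono [pp [bot [lim succ]]]]]]]]].
pose level x i := A i x /\ forall i', A i' x -> (i <= i')%O.
pose isp (j i : I) := (j < i)%O /\ forall k, ~ ((j < k)%O /\ (k < i)%O).
have pureA i : pure_subgroup (A i) by have [] := pp i.
have sA i : subgroup (A i) by have [] := pureA i.
have ex_level x : exists i, level x i.
  have : [set: G] x by []; rewrite -cover => -[i _ Aix].
  by apply: (wo_min Iwo); exists i.
(* Continuity and the zero bottom member make the level of a nonzero element a successor. *)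
have ex_pred x i : x != 0 -> level x i -> exists2 j, isp j i & ~ A j x.
  move=> x0 [Aix mini].
  have [i0|/existsNP[i0 i0i]] := pselect (forall j, (i <= j)%O).
    by move: Aix x0; rewrite (bot i i0) => -> /eqP.
  have {}i0i : (i0 < i)%O by rewrite ltNge; exact/negP.
  have [|nlim] := pselect
    (forall i', (i' < i)%O -> exists k, (i' < k)%O /\ (k < i)%O).
    move=> li; have : A i x by [].
    rewrite (lim i) => [[j /= ji Ajx]|]; last by split; [exists i0|].
    by have := mini j Ajx; rewrite leNgt ji.
  have /existsNP[j /not_implyP[ji nk]] := nlim.
  exists j; first by split=> // k jk; apply: nk; exists k.
  by move=> /mini; rewrite leNgt ji.
have preb j x : ~ A j x -> exists w, pred_member (A j) x w.
  move=> nAx; have [_ /(_ x nAx)[w [Aw wP]]] := pp j.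
  exists w; split=> // y /wP[n [l [l0 /type_le_cov]]].
  by exists n, l.
have /boolp.choice[w wP] x : exists w, forall i j,
    x != 0 -> level x i -> isp j i -> pred_member (A j) x w.
  have [->|x0] := eqVneq x 0; first by exists (fun=> 0).
  have [i li] := ex_level x; have [j [ji jP] /preb[wx wxP]] := ex_pred x i x0 li.
  exists wx => i' j' _ li' [ji' jP'].
  have ii' : i = i'.
    by apply/eqP; rewrite eq_le (li.2 _ li'.1) (li'.2 _ li.1).
  suff <- : j = j' by [].
  rewrite -ii' in ji' jP'; have [jj'|jj'|//] := ltgtP j j'.
    by exfalso; apply: (jP j').
  by exfalso; apply: (jP' j).
exists w => X sX wX h0; have [i0 li0] := ex_level h0.
elim/(wo_ind Iwo): i0 h0 li0 => i IHi h [Aih minh].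
have [->|h0] := eqVneq h 0.
  by exists [set 0]; apply: witnesses_mem; exact: subgroup0.
have [j [ji jP] nAjh] := ex_pred h i h0 (conj Aih minh).
have IHj g : A j g -> exists Om, witnesses X g Om.
  move=> Ajg; have [i' [Ai'g mini']] := ex_level g.
  by apply: (IHi i') => //; apply: le_lt_trans ji; exact: mini'.
(* If [X] has an element [x0] that is new at the level of [h], rank one brings a multiple of [h],
   minus a multiple of [x0], into [A j], where the induction hypothesis applies. *)
have [[x0 [Xx0 Aix0 nAjx0]]|nX] := pselect
  (exists x0, [/\ X x0, A i x0 & ~ A j x0]).
  have [l0 [z [l00 Ag]]] :=
    quotient_rank1 (pureA j) (succ j i (conj ji jP)) Aix0 nAjx0 Aih.
  set g := h *+ l0 - x0 *~ z in Ag.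
  have [Om [Omc OmX OmP]] := IHj g Ag.
  exists [set x0 *~ u.1 + u.2 | u in [set: int] `*` Om]; split.
  - apply: card_le_trans (card_image_le _ _) _.
    by apply: countableX; [exact: countableP|].
  - move=> _ [[u v] [_ /OmX Xv] <-]; apply: subgroupD => //; exact: subgroupMz.
  move=> l x lp Xx; apply: (cov_trans _ (cov1 _)) => // _ ->.
  pose x' := x *+ l0 - x0 *~ z *+ l.
  have Xx' : X x' by apply: subgroupB => //; apply: subgroupMn => //; exact: subgroupMz.
  have [C [Cfin CS] Ccov] := OmP l x' lp Xx'.
  have gE : g *+ l - x' = (h *+ l - x) *+ l0.
    rewrite /g /x' !mulrnBl -!mulrnA [(l * l0)%N]mulnC opprB addrA.
    by rewrite subrK.
  exists (g *+ l - x'), C; split=> // [n na _|y /CS[l' [o [l'0 Omo yE]]]].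
    by rewrite gE; exact: ndividesMn.
  exists y => //; exists (l0 * l')%N, (x0 *~ (z * l'%:Z) + o); split.
  - by rewrite muln_gt0 l00.
  - by exists (z * l'%:Z, o).
  - by rewrite yE /g mulrnBl -mulrnA opprD addrA mulrzA.
(* Now [X] meets [A i] only inside [A j]. The witnesses in [A j] for the multiples of [h] are
   replaced by countable subsets of [X] that witness at them. *)
have nAjl l : (0 < l)%N -> ~ A j (h *+ l).
  by move=> l0 /(pure_subgroupMn (pureA j) l0).
have /boolp.choice[g gP] l : exists g : nat -> G,
    (0 < l)%N -> pred_member (A j) (h *+ l) g.
  have [l0|] := ltnP 0 l; last by exists (fun=> 0).
  by have [gl] := preb j _ (nAjl l l0); exists gl.
have /boolp.choice[Om OmP] (lk : nat * nat) : exists Om,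
    (0 < lk.1)%N -> witnesses X (g lk.1 lk.2) Om.
  have [l0|] := ltnP 0 lk.1; last by exists set0.
  by have [Ag _] := gP _ l0; have [Om OmP] := IHj _ (Ag lk.2); exists Om.
pose U := \bigcup_(lk in [set lk : nat * nat | (0 < lk.1)%N]) Om lk.
exists U; split.
- by apply: bigcup_countable => [|lk lk0]; [exact: countableP|have [] := OmP lk lk0].
- by move=> o [lk lk0 Omo]; have [_ + _] := OmP lk lk0; apply.
have low l x : (0 < l)%N -> X x -> A j x ->
    exists2 B, finite_set B /\ B `<=` shifts h U & cov B (h *+ l - x).
  move=> l0 Xx Ax; have [Ag /(_ x Ax)[n [l1 [l10 covb]]]] := gP l l0.
  apply: (cov_trans (finite_le_image _ _) covb) => _ [k kn ->].
  have [_ _ /(_ 1%N (x *+ l1) isT (subgroupMn _ sX Xx))[C [Cfin CS] Ccov]] :=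
    OmP (l, k) l0.
  exists (g l k *+ 1 - x *+ l1), C; split=> // [m ma mb|y /CS[l2 [o [l20 Omo yE]]]].
    suff -> : g l k *+ 1 - x *+ l1 = (h *+ l - x) *+ l1 - (h *+ l *+ l1 - g l k).
      by apply: ndividesB => //; exact: ndividesMn.
    by rewrite mulrnBl mulr1n opprB [RHS]addrC addrA subrK.
  exists ((h *+ l *+ l1 - g l k) *+ l2 + y).
    exists (l * l1 * l2)%N, o; split; first by rewrite !muln_gt0 l0 l10.
      by exists (l, k).
    by rewrite yE mulrnBl addrA subrK !mulrnA.
  by move=> m _ mb my; apply: ndividesD => //; exact: ndividesMn.
(* For [x] outside [A j], the member just before the level of [x] contains [h], so the roles are
   reversed: the witnesses [w x k], in [X] by closure and of lower level, are used for [x] against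
   [h *+ l]. *)
move=> l x l0 Xx; have [ix lx] := ex_level x.
elim/(wo_ind Iwo): ix x Xx lx l l0 => ix IHx x Xx [Ax minx] l l0.
have [Ajx|nAjx] := pselect (A j x); first exact: low.
have iix : (i < ix)%O.
  rewrite ltNge; apply/negP => ixi; apply: nX; exists x; split=> //.
  exact: mono Ax.
have x0 : x != 0 by apply/eqP => x0; apply: nAjx; rewrite x0; exact: subgroup0.
have [j' j'P nAj'x] := ex_pred x ix x0 (conj Ax minx).
have [j'ix jP'] := j'P.
have ij' : (i <= j')%O by rewrite leNgt; apply/negP => j'i; exact: (jP' i).
have [Awx wxP] := wP x ix j' x0 (conj Ax minx) j'P.
have [n [l1 [l10 covb]]] := wxP (h *+ l) (subgroupMn _ (sA _) (mono _ _ ij' _ Aih)).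
apply: (cov_trans (finite_le_image _ _)).
  by apply: covN; rewrite opprB; exact: covb.
move=> _ [k kn ->]; have [iw [Aw minw]] := ex_level (w x k).
have iwx : (iw < ix)%O by apply: le_lt_trans j'ix; exact: minw.
have ll0 : (0 < l * l1)%N by rewrite muln_gt0 l0.
have [C [Cfin CS] Ccov] := IHx iw iwx _ (wX x k Xx) (conj Aw minw) _ ll0.
exists (h *+ (l * l1) - w x k), C; split=> // [m ma mb|y Cy].
  suff -> : h *+ (l * l1) - w x k = (h *+ l - x) *+ l1 + (x *+ l1 - w x k).
    by apply: ndividesD => //; exact: ndividesMn.
  by rewrite mulrnBl addrA subrK mulrnA.
by exists y => //; exact: CS.
Qed.

End Chain.

(** * The agreement group *)

Section LocalIntegrality.
Local Open Scope ring_scope.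

(** Membership in the integers localized at [p]. *)
Definition pint (p : nat) (q : rat) : Prop :=
  exists (m : nat) (z : int), ~~ (p %| m)%N /\ q * m%:R = z%:~R.

Lemma pint_int p (z : int) : prime p -> pint p z%:~R.
Proof.
move=> pp; exists 1%N, z; rewrite mulr1; split=> //.
by rewrite dvdn1 neq_ltn prime_gt1 ?orbT.
Qed.

Lemma pintB p q r : prime p -> pint p q -> pint p r -> pint p (q - r).
Proof.
move=> pp [m [z [pm qm]]] [n [t [pn rn]]].
exists (m * n)%N, (z * n%:Z - t * m%:Z); split.
  by rewrite Euclid_dvdM// negb_or pm.
rewrite natrM mulrBl mulrA qm [m%:R * _]mulrC mulrA rn.
by rewrite rmorphB !rmorphM.
Qed.

Lemma pint_div p r k q : prime p -> prime r -> p != r ->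
  pint p q -> pint p (q / (r ^ k)%:R).
Proof.
move=> pp pr npr [m [z [pm qm]]]; exists (m * r ^ k)%N, z; split.
  rewrite Euclid_dvdM// negb_or pm /= Euclid_dvdX// negb_and dvdn_prime2//.
  by rewrite npr.
rewrite natrM [m%:R * _]mulrC mulrA divfK//.
by rewrite pnatr_eq0 -lt0n expn_gt0 prime_gt0.
Qed.

Lemma pint_divisible_eq0 p q : prime p ->
  (forall k, exists2 r, pint p r & q = r *+ (p ^ k)) -> q = 0.
Proof.
move=> pp qdiv; apply/eqP; rewrite -numq_eq0 -absz_eq0; apply/negPn/negP => q0.
(* With the absolute value of the numerator as exponent, the power of [p] exceeds the numerator that
   it would have to divide. *)
have [r [m [z [pm rm]]] qr] : exists2 r, pint p r & q = r *+ (p ^ `|numq q|).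
  exact: qdiv.
have eqz : numq q * m%:Z = z * (p ^ `|numq q|)%:Z * denq q.
  apply: (@intr_inj rat); rewrite !rmorphM /= numqE {1}qr -mulr_natr.
  rewrite -rm !pmulrn; ring.
have : (p ^ `|numq q| %| `|numq q| * m)%N.
  by rewrite -[m]/`|m%:Z|%N -abszM eqz !abszM /= mulnAC dvdn_mull.
rewrite Gauss_dvdl; last by apply: coprimeXl; rewrite prime_coprime.
move=> /dvdn_leq; rewrite lt0n => /(_ q0); rewrite leqNgt => /negP; apply.
by apply: ltn_expl; exact: prime_gt1.
Qed.
End LocalIntegrality.

Section Agreement.
Variable V : choiceType.
Local Open Scope ring_scope.
Implicit Types (u : nat -> V) (g h : (nat -> V) -> rat) (v : V) (p : nat).

Definition supported (r : seq (nat -> V)) g := forall u, u \notin r -> g u = 0.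

(** Adding multiples of [u - u'] with [u p = u' p] leaves these class sums unchanged; they detect
    divisibility by all powers of [p]. *)
Definition csum p v g := \sum_(u \in [set` [pred u : nat -> V | u p == v]]) g u.

Lemma csumE r p v g : supported r g ->
  csum p v g = \sum_(u <- undup r | u p == v) g u.
Proof.
move=> rg; rewrite /csum -(@bigfs _ _ _ _ (undup r)) ?undup_uniq//.
by move=> u _; rewrite mem_undup => /rg.
Qed.

Lemma supportedB r r' g h : supported r g -> supported r' h ->
  supported (r ++ r') (g - h).
Proof.
move=> rg rh u; rewrite mem_cat negb_or => /andP[ur ur'].
by rewrite -[(g - h) u]/(g u - h u) rg// rh// subrr.
Qed.

Lemma supported_cat r r' g : supported r g -> supported (r ++ r') g.
Proof. by move=> rg u; rewrite mem_cat negb_or => /andP[/rg]. Qed.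

Lemma supported_catr r r' g : supported r' g -> supported (r ++ r') g.
Proof. by move=> rg u; rewrite mem_cat negb_or => /andP[_ /rg]. Qed.

Lemma csumB r r' p v g h : supported r g -> supported r' h ->
  csum p v (g - h) = csum p v g - csum p v h.
Proof.
move=> rg rh; rewrite (csumE _ _ (supportedB rg rh)).
rewrite (csumE _ _ (supported_cat (r' := r') rg)) (csumE _ _ (supported_catr (r := r) rh)).
by rewrite -sumrB.
Qed.

Lemma csum_scale r p v g (c : rat) : supported r g ->
  csum p v (fun u => g u * c) = csum p v g * c.
Proof.
move=> rg; rewrite (csumE _ _ rg) (@csumE r) ?mulr_suml// => u /rg ->.
by rewrite mul0r.
Qed.

(** A description by localizations: at [p], the quotients of the differences [u - u'] fill the space
    where the class sums vanish, so only integrality of these sums remains to be required. *)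
Definition agreement : {pred (nat -> V) -> rat} := fun g => `[<
  (exists r, supported r g) /\ forall p v, prime p -> pint p (csum p v g) >].

Lemma agreement_closed : zmod_closed agreement.
Proof.
split.
  apply/asboolP; split; first by exists [::].
  move=> p v pp; rewrite (@csumE [::])// big_nil.
  exact: (@pint_int p 0).
move=> g h /asboolP[[r rg] gint] /asboolP[[r' rh] hint]; apply/asboolP; split.
  by exists (r ++ r'); exact: supportedB.
by move=> p v pp; rewrite (csumB _ _ rg rh); apply: pintB; [|exact: gint|exact: hint].
Qed.

HB.instance Definition _ :=
  GRing.isZmodClosed.Build ((nat -> V) -> rat) agreement agreement_closed.

(* The subgroup of the rational vector space on [nat -> V] generated by the
   basis and the quotients [(u - u') / p ^ k], for [p] prime and [u p = u' p].
   Only the values of [u] at primes play a role. *)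
Record agroup : Type := Agroup { acoef :> (nat -> V) -> rat; _ : acoef \in agreement }.

HB.instance Definition _ := [isSub for acoef].
HB.instance Definition _ := [Choice of agroup by <:].
HB.instance Definition _ := [SubChoice_isSubZmodule of agroup by <:].

Implicit Types x y : agroup.

Lemma acoefP x : (exists r, supported r x) /\
  forall q w, prime q -> pint q (csum q w x).
Proof. by case: x => c /= /asboolP. Qed.

Lemma acoef_inj : injective acoef.
Proof. exact: val_inj. Qed.

Lemma acoefB x y : acoef (x - y) = acoef x - acoef y.
Proof. exact: (raddfB (val : agroup -> _)). Qed.

Lemma acoefD x y : acoef (x + y) = acoef x + acoef y.
Proof. exact: (raddfD (val : agroup -> _)). Qed.

Lemma acoefMn x n : acoef (x *+ n) = (fun u => x u * n%:R).
Proof.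
apply/funext => u; elim: n => [|n IHn]; first by rewrite mulr0.
rewrite mulrS acoefD -[(_ + _) u]/(x u + (x *+ n) u) IHn.
by rewrite -addn1 natrD mulrDr mulr1 addrC.
Qed.

Lemma acsumB p v x y : csum p v (x - y) = csum p v x - csum p v y.
Proof.
have [[[r rx] _] [[r' ry] _]] := (acoefP x, acoefP y).
by rewrite acoefB (csumB _ _ rx ry).
Qed.

Lemma acsumMn p v x n : csum p v (x *+ n) = csum p v x * n%:R.
Proof. by have [[r rx] _] := acoefP x; rewrite acoefMn (csum_scale _ _ _ rx). Qed.

Lemma agroup_torsion_free : @torsion_free agroup.
Proof.
move=> x n n0 xn; apply: acoef_inj; apply/funext => u.
have /(congr1 (fun y : agroup => y u)) := xn; rewrite acoefMn => /eqP.
by rewrite mulf_eq0 pnatr_eq0 (gtn_eqF n0) orbF => /eqP ->.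
Qed.

(** A [p]-integral class sum divisible by every power of [p] vanishes. Conversely, division by
    [p ^ k] keeps zero sums zero and preserves integrality at the other primes. *)
Lemma agroup_divisibleP (p : prime_number) x :
  (forall k, ndivides (val p ^ k) x) <-> (forall v, csum (val p) v x = 0).
Proof.
have pp := valP p; split=> [xdiv v|x0 k].
  apply: (pint_divisible_eq0 pp) => k; have [y ->] := xdiv k.
  exists (csum (val p) v y); first by have [_] := acoefP y; apply.
  by rewrite acsumMn mulr_natr.
have [[r rx] xint] := acoefP x.
have pk0 : (val p ^ k)%:R != 0 :> rat.
  by rewrite pnatr_eq0 -lt0n expn_gt0 prime_gt0.
have yP : (fun u => x u * (val p ^ k)%:R^-1) \in agreement.
  apply/asboolP; split; first by exists r => u /rx ->; rewrite mul0r.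
  move=> q v qp; rewrite (csum_scale _ _ _ rx).
  have [->|qnp] := eqVneq q (val p); last by apply: pint_div => //; exact: xint.
  by rewrite x0 mul0r; exact: (@pint_int _ 0).
exists (Agroup yP); apply: acoef_inj; rewrite acoefMn; apply/funext => u /=.
by rewrite mulfVK.
Qed.

Fact unit_coef_agreement u : (fun u' => (u' == u)%:R) \in agreement.
Proof.
have ur : supported [:: u] (fun u' => (u' == u)%:R).
  by move=> u'; rewrite inE => /negPf ->.
apply/asboolP; split; first by exists [:: u].
move=> p v pp; rewrite (csumE _ _ ur) big_mkcond big_seq1 eqxx.
by case: ifP => _; [exact: (@pint_int _ 1)|exact: (@pint_int _ 0)].
Qed.

Definition agen u : agroup := Agroup (unit_coef_agreement u).

Lemma agenE u u' : agen u u' = (u' == u)%:R.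
Proof. by []. Qed.

Lemma csum_agen p v u : csum p v (agen u) = (u p == v)%:R.
Proof.
have ur : supported [:: u] (agen u) by move=> u'; rewrite inE agenE => /negPf ->.
by rewrite (csumE _ _ ur) big_mkcond big_seq1 agenE eqxx; case: eqP.
Qed.

Lemma agen_inj : injective agen.
Proof.
move=> u u' /(congr1 (fun x : agroup => x u)); rewrite !agenE eqxx.
by have [//|_ /eqP] := eqVneq u u'; rewrite oner_eq0.
Qed.

Lemma agen_divisible (p : prime_number) u u' k : u (val p) = u' (val p) ->
  ndivides (val p ^ k) (agen u - agen u').
Proof.
move=> uu'; move: k; apply/agroup_divisibleP => v.
by rewrite acsumB !csum_agen uu' subrr.
Qed.

(** The class sum of [x] at the value [u p] has to equal [l], which is nonzero, so the support of
    [x] meets that class. *)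
Lemma agen_divisible_support (p : prime_number) u l x : (0 < l)%N ->
  (forall k, ndivides (val p ^ k) (agen u *+ l - x)) ->
  exists2 u', x u' != 0 & u' (val p) = u (val p).
Proof.
move=> l0 /agroup_divisibleP/(_ (u (val p))).
rewrite acsumB acsumMn csum_agen eqxx mul1r => /eqP; rewrite subr_eq0 => /eqP xl.
have [[r rx] _] := acoefP x; apply: contrapT => none.
move: xl; rewrite (csumE _ _ rx) big1 => [/eqP|u' /eqP uu'].
  by rewrite pnatr_eq0 gtn_eqF.
by apply/eqP/negPn/negP => xu'; apply: none; exists u'.
Qed.

Lemma agroup_support x : exists r : seq (nat -> V), forall u, (u \in r) = (x u != 0).
Proof.
have [[r rx] _] := acoefP x; exists [seq u <- r | x u != 0] => u.
rewrite mem_filter; case: eqP => //= xu; apply/negPn/negP => /rx.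
exact: xu.
Qed.

Lemma agroup_code : exists2 code : agroup -> seq (rat * (nat -> V)),
  injective code & forall x c, c \in code x -> x c.2 != 0.
Proof.
have /boolp.choice[r rP] := agroup_support.
exists (fun x => [seq (x u, u) | u <- r x]); last first.
  by move=> x c /mapP[u]; rewrite rP => xu ->.
move=> x y xy.
have rxy : r x = r y.
  have /(congr1 (map snd)) := xy.
  by rewrite -!map_comp !(map_id_in (s := r _)).
apply: acoef_inj; apply/funext => u.
have [ux|ux] := boolP (u \in r x); last first.
  have: u \notin r y by rewrite -rxy.
  by move: ux; rewrite !rP !negbK => /eqP-> /eqP->.
have : (x u, u) \in [seq (y u, u) | u <- r y].
  by rewrite -xy; apply/mapP; exists u.
by move=> /mapP[u' _ [-> ->]].
Qed.

End Agreement.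

(** * The group of functions into aleph_omega *)

Fixpoint nth_prime n : nat :=
  if n is m.+1 then s2val (prime_above (nth_prime m)) else 2.

Lemma nth_primeP n : prime (nth_prime n).
Proof. by case: n => //= n; exact: s2valP' (prime_above _). Qed.

Lemma nth_prime_inj : injective nth_prime.
Proof.
apply: incn_inj; apply: leq_mono; apply: homo_ltn; first exact: ltn_trans.
by move=> n; exact: s2valP (prime_above _).
Qed.

Lemma countable_prime_enum T (A : set T) : countable A -> A !=set0 ->
  exists u : nat -> A, forall x, A x -> exists p : prime_number, val (u (val p)) = x.
Proof.
move=> /card_le_injects[j ji] [x0 Ax0].
have [_ N2] := setT_injects nat.
pose i (x : A) := nth_prime (val (j x)).
have ii : injective i by move=> x y /nth_prime_inj/val_inj/ji.
exists (fun n => if pselect (exists x, i x = n) is left e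
  then projT1 (cid e) else SigSub (mem_set Ax0)) => x Ax.
exists (exist _ (i (SigSub (mem_set Ax))) (nth_primeP _)) => /=.
case: pselect => [e|[]]; last by exists (SigSub (mem_set Ax)).
by case: cid => y /= /ii ->.
Qed.

Section Star.
Context {d : Order.disp_t} {W : orderType d}.
Hypothesis gch : GCH.
Hypothesis Wom : is_omega_omega1 W.
Let Wwo : well_order (<=%O : rel W). Proof. by have [] := Wom. Qed.
Variables (w : W) (f : W -> nat -> W).
Hypothesis wom : is_omega_omega w.
Hypothesis fw : forall a n, seg w (f a n).
Hypothesis fsurj :
  forall g : nat -> W, (forall n, seg w (g n)) -> exists a, f a = g.
Local Open Scope order_scope.

Notation K := (set_type (seg w)).

Lemma beth_omega n : injects (beth n) K.
Proof. by have [/(is_aleph_omegaP gch)[]] := wom. Qed.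

(** [B] has cardinality aleph_omega and [W] that of its successor. Minimality of aleph_omega above
    all [beth n] lets [B] inject in [K]. *)
Lemma omegaW_bound : exists B : set W, injects B K /\
  forall C : set W, injects C B \/ injects W C.
Proof.
have [_ [B [_ /(is_aleph_omegaP gch)[nB minB] [_ _ succ]]] _] := Wom.
have [_ W2] := setT_injects W; have [W1 _] := setT_injects W.
exists B; split; last first.
  move=> C; have [/card_le_injects|/card_le_injects] := succ C (fun _ _ => I).
    by left.
  by right; exact: injects_trans W1 _.
have [//|[h hi]] := injects_total B K.
have [KC CK] := injects_range (inj_comp val_inj hi).
apply: injects_trans CK; apply: minB.
  by move=> _ [x _ <-] /=; exact: set_valP.
by move=> n; apply: injects_trans KC; exact: beth_omega.
Qed.

Lemma seg_injects (a : W) : injects (seg a) K.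
Proof.
have [B [BK /(_ (seg a))[aB|Wa]]] := omegaW_bound.
  exact: injects_trans BK.
have [_ _ /(_ a)[]] := Wom; apply/card_le_injects.
exact: injects_trans (setT_injects W).2 Wa.
Qed.

(* König's argument: [K] is a countable union of sets injecting in some [beth n],
   so [nat -> K] can be diagonalised against [K * K] one coordinate at a time. *)
Lemma konig (G : K * K -> nat -> K) : exists g, forall x, G x <> g.
Proof.
pose h n := projT1 (cid (beth_omega n)).
have hi n : injective (h n) by exact: projT2 (cid (beth_omega n)).
pose R : set W := \bigcup_n range (val \o h n).
have [i ii] : injects K R.
  have [/(is_aleph_omegaP gch)[_ minw] _] := wom; apply: minw.
    by move=> _ [n _ [x _ <-]] /=; exact: set_valP.
  move=> n; have [nh _] := injects_range (inj_comp val_inj (hi n)).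
  by apply: injects_trans nh (sub_injects _) => x hx; exists n.
pose A n : set K := [set x | range (val \o h n) (val (i x))].
have An n : injects (A n) (beth n).
  have [_ hn] := injects_range (inj_comp val_inj (hi n)).
  apply: injects_trans hn.
  have Ar (x : A n) : val (i (val x)) \in range (val \o h n).
    by apply/mem_set; exact: (set_valP x).
  by exists (fun x => SigSub (Ar x)) => x y [] /val_inj/ii/val_inj.
have covA x : exists n, A n x.
  by have [n _ rx] := set_valP (i x); exists n.
(* Coordinate [k] codes a pair of pieces; a member of [K * K] is refuted at the coordinate coding
   the pieces that contain it. *)
pose dec k : nat * nat := odflt (0, 0)%N (unpickle k).
have /boolp.choice[g gP] k : exists y, forall x,
    A (dec k).1 x.1 -> A (dec k).2 x.2 -> G x k <> y.
  (* If every value were excluded, [K] would inject in a product of two pieces, hence in a single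
     [beth n]. *)
  apply: contrapT => /forallNP nk.
  have /boolp.choice[e eP] y :
      exists x : A (dec k).1 * A (dec k).2, G (val x.1, val x.2) k = y.
    have /existsNP[[x1 x2] /not_implyP[A1 /not_implyP[A2 /contrapT xy]]] := nk y.
    by exists (SigSub (mem_set A1), SigSub (mem_set A2)).
  have ei : injective e by move=> y y' ee; rewrite -(eP y) ee.
  pose n := maxn (dec k).1 (dec k).2.
  apply: (@cantor (beth n)); apply: injects_trans (beth_omega n.+1) _.
  apply: injects_trans (beth_square n); apply: injects_trans (ex_intro _ e ei) _.
  apply: injects_prod; apply: injects_trans (An _) (beth_le _).
    exact: leq_maxl.
  exact: leq_maxr.
exists g => -[x1 x2]; have [n1 A1] := covA x1; have [n2 A2] := covA x2.
move=> /(congr1 (fun u => u (pickle (n1, n2)))); apply: gP;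
  by rewrite /dec pickleK.
Qed.

Lemma konig_injects (T : Type) : injects T (K * K) ->
  ~ (exists h : T -> nat -> K, forall u, exists t, h t = u).
Proof.
move=> [i ii] [h hs]; have [k0 _] := hs (fun=> SigSub (mem_set (fw w 0%N))).
have [g gP] := konig (fun x => if pselect (exists t, i t = x) is left e
   then h (projT1 (cid e)) else fun=> h k0 0%N).
have [t ht] := hs g; apply: (gP (i t)); case: pselect => [e|[]]; last by exists t.
by case: cid => t' /= /ii ->.
Qed.

Definition fK (a : W) (n : nat) : K := SigSub (mem_set (fw a n)).

Lemma fK_surj u : exists a, fK a = u.
Proof.
have [a fa] := fsurj (fun n => set_valP (u n)); exists a.
by apply/funext => n; apply: val_inj; rewrite /= fa.
Qed.

Lemma omegaW_square : ~ injects W (K * K).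
Proof. by move=> /konig_injects; apply; exists fK; exact: fK_surj. Qed.

Lemma omegaW_fun : injects W (nat -> K) /\ injects (nat -> K) W.
Proof.
have XW : injects (nat -> K) W by apply: surj_injects fK_surj.
split=> //; have [h hi] := XW; have [Xr rX] := injects_range hi.
have [B [BK /(_ (range h))[rB|Wr]]] := omegaW_bound.
  exfalso; apply: (@konig_injects (nat -> K)); last by exists id => u; exists u.
  apply: injects_trans Xr (injects_trans rB (injects_trans BK _)).
  by exists (fun x => (x, x)) => x y [].
exact: injects_trans Wr rX.
Qed.

(** With a largest element [a], [W] would be [seg a] and one more point, which fits in [K * K] with
    the second coordinate as a tag. *)
Lemma no_max (a : W) : exists b, a < b.
Proof.
apply: contrapT => /forallNP amax; apply: omegaW_square.
have [j ji] := seg_injects a; have [h hi] := beth_omega 0.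
have ax x : ~ seg a x -> x = a.
  by rewrite /seg/= => /negP; rewrite -leNgt le_eqVlt => /orP[/eqP//|/amax].
exists (fun x => if pselect (seg a x) is left p
  then (j (SigSub (mem_set p)), h 1%N) else (h 0%N, h 0%N)) => x y.
case: pselect => [xa|/ax->]; case: pselect => [ya|/ax->] //.
- by case=> /ji [].
- by case=> _ /hi.
- by case=> _ /hi.
Qed.

(* [T] has cardinality less than the cofinality of [W]. *)
Definition narrow (T : Type) := forall h : T -> W, exists b, forall t, h t < b.

(** Regularity of the successor cardinal: an unbounded map would cover [W] by few initial segments,
    each injecting in [K], and so send [W] into [K * K]. *)
Lemma injects_narrow T : injects T K -> narrow T.
Proof.
move=> [i ii] h; suff [b hb] : exists b, forall t, h t <= b.
  by have [c bc] := no_max b; exists c => t; exact: le_lt_trans bc.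
apply: contrapT => /forallNP unb; apply: omegaW_square.
have /boolp.choice[t tP] b : exists t, seg (h t) b.
  by have /existsNP[t /negP] := unb b; rewrite -ltNge; exists t.
pose j a := projT1 (cid (seg_injects a)).
have ji a : injective (j a) by exact: projT2 (cid (seg_injects a)).
exists (fun b => (i (t b), j (h (t b)) (SigSub (mem_set (tP b))))) => b c [/ii tbc].
move: (tP b) (tP c); rewrite tbc => pb pc /ji [].
by [].
Qed.

Lemma narrow_injects T U : injects T U -> narrow U -> narrow T.
Proof.
move=> [i ii] nU h; have [a _] : exists a : W, True by exists w.
have [b hb] := nU (fun u => if pselect (exists t, i t = u) is left e
   then h (projT1 (cid e)) else a).
exists b => t; have := hb (i t); case: pselect => [e|[]]; last by exists t.
by case: cid => t' /= /ii ->.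
Qed.

Lemma narrow_seg (a : W) : narrow (seg a).
Proof. exact/injects_narrow/seg_injects. Qed.

Lemma narrow_beth n : narrow (beth n).
Proof. exact/injects_narrow/beth_omega. Qed.

Lemma narrow_count (T : countType) : narrow T.
Proof. exact: narrow_injects (injects_count T) (@narrow_beth 0). Qed.

Lemma narrow_nat_fun : narrow (nat -> nat).
Proof.
apply: narrow_injects (@narrow_beth 1).
apply: injects_trans (injects_set (injects_count (nat * nat)%type)).
exists (fun u => [set x | u x.1 = x.2]) => u v /seteqP[uv _].
by apply/funext => n; apply/esym; exact: (uv (n, u n)).
Qed.

Lemma narrow_prod T U : narrow T -> narrow U -> narrow (T * U).
Proof.
move=> nT nU h; have /boolp.choice[b hb] t := nU (fun u => h (t, u)).
by have [c bc] := nT b; exists c => -[t u]; exact: lt_trans (bc t).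
Qed.

Lemma narrow_seq T : narrow T -> narrow (seq T).
Proof.
move=> nT h; have /boolp.choice[b hb] n :
    exists b, forall s, size s = n -> h s < b.
  elim: n h => [|n IHn] h.
    by have [b hb] := no_max (h [::]); exists b => s /size0nil->.
  have /boolp.choice[b hb] t := IHn (fun s => h (t :: s)).
  have [c bc] := nT b; exists c => -[//|t s] [sn].
  exact: lt_trans (hb t s sn) (bc t).
by have [c bc] := narrow_count b; exists c => s; exact: lt_trans (hb _ s erefl) _.
Qed.

Lemma seq_fun_injects : injects (seq (rat * (nat -> K))) (nat -> K).
Proof.
have [h hi] := beth_omega 0.
(* [onth] returns [None] past the end, so the code also determines the length. *)
pose code (s : seq (rat * (nat -> K))) k := match unpickle k with
  | Some (inl i) => h (pickle (onth (map fst s) i))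
  | Some (inr (i, j)) => nth (fun=> h 0%N) (map snd s) i j
  | None => h 0%N end.
exists code => s s' ss'.
have code1 i : onth (map fst s) i = onth (map fst s') i.
  have := congr1 (fun u => u (pickle (inl i : nat + nat * nat))) ss'.
  by rewrite /code pickleK => /hi /(pcan_inj pickleK).
have code2 i : nth (fun=> h 0%N) (map snd s) i = nth (fun=> h 0%N) (map snd s') i.
  apply/funext => j.
  have := congr1 (fun u => u (pickle (inr (i, j) : nat + nat * nat))) ss'.
  by rewrite /code pickleK.
have fsts : map fst s = map fst s'.
  by apply: eq_from_onth.
have szs : size s = size s' by rewrite -(size_map fst s) fsts size_map.
have snds : map snd s = map snd s'.
  by apply: (@eq_from_nth _ (fun=> h 0%N)); rewrite ?size_map.
by rewrite -[s]zip_unzip -[s']zip_unzip /unzip1 /unzip2 fsts snds.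
Qed.

(** A closure point above [a] is the least strict upper bound of the iterates at [a] of a function
    [M] that bounds [m] on initial segments. *)
Lemma closure_club (m : W -> W) : exists2 C : set W, club C &
  forall b, C b -> forall a, a < b -> m a < b.
Proof.
exists [set b | forall a, a < b -> m a < b]; last by [].
split=> [a|b _ blim a ab]; last first.
  have [c [Cc ac cb]] := blim a ab; exact: lt_trans (Cc a ac) cb.
have /boolp.choice[M MP] c : exists c', c < c' /\ forall x, x < c -> m x < c'.
  have [c1 c1P] := narrow_seg (fun x : seg c => m (val x)).
  have [c2 cc2] := no_max c; have [lec|lec] := leP c1 c2.
    exists c2; split=> // x xc.
    by apply: lt_le_trans lec; exact: (c1P (SigSub (mem_set (xc : seg c x)))).
  exists c1; split; first exact: lt_trans lec.
  by move=> x xc; exact: (c1P (SigSub (mem_set (xc : seg c x)))).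
have [b1 b1P] := narrow_count (fun n => iter n M a).
have [b [bP minb]] : exists b, (forall n, iter n M a < b) /\
    forall b', (forall n, iter n M a < b') -> b <= b'.
  by apply: wo_min => //; exists b1.
exists b; last exact: (bP 0%N).
move=> x xb; have [n xn] : exists n, x < iter n M a.
  apply: contrapT => /forallNP nx; have : b <= x; last by rewrite leNgt xb.
  apply: minb => n; have [_ _] := MP (iter n M a).
  have : iter n.+1 M a <= x by rewrite leNgt; apply/negP/nx.
  by apply: lt_le_trans; have [+ _] := MP (iter n M a).
by have [_ /(_ x xn) h] := MP (iter n M a); apply: lt_trans h (bP n.+1).
Qed.

(** * The filtration of the group by the levels of supports *)

Notation G := (agroup K).

Definition level (u : nat -> K) : W := projT1 (cid (fK_surj u)).

Lemma levelK u : fK (level u) = u.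
Proof. exact: projT2 (cid (fK_surj u)). Qed.

Lemma level_inj : injective level.
Proof. by move=> u v uv; rewrite -(levelK u) uv levelK. Qed.

Definition below (b : W) : set G :=
  [set x : G | forall u, (x u != 0)%R -> level u < b].

Lemma below_subgroup b : subgroup (below b).
Proof.
split; first by apply/mem_set => u; rewrite eqxx.
move=> x y /set_mem xb /set_mem yb; apply/mem_set => u.
rewrite acoefB -[(_ - _)%R u]/(x u - y u)%R => xyu.
have [xu|/xb//] := eqVneq (x u) 0%R; have [yu|/yb//] := eqVneq (y u) 0%R.
by move: xyu; rewrite xu yu subrr eqxx.
Qed.

Lemma below_sub b c : b <= c -> below b `<=` below c.
Proof. by move=> bc x xb u /xb /lt_le_trans; apply. Qed.

Lemma below_agen b u : level u < b -> below b (agen u).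
Proof.
move=> ub u'; rewrite agenE; have [->//|_] := eqVneq u' u.
by rewrite eqxx.
Qed.

Lemma below_ex (x : G) : exists b, below b x.
Proof.
have [r rx] := agroup_support x.
have [b bP] := narrow_count (fun i : 'I_(size r) => level (tnth (in_tuple r) i)).
exists b => u; rewrite -rx => /(nthP u)[i ir <-].
by have := bP (Ordinal ir); rewrite (tnth_nth u).
Qed.

(** A finite support has a largest level; [a0] serves the empty support. *)
Lemma below_ltP b x a0 : a0 < b -> below b x ->
  exists2 a, a < b & forall u, (x u != 0)%R -> level u <= a.
Proof.
move=> a0b xb; have [r rx] := agroup_support x.
have : forall u, u \in r -> level u < b by move=> u; rewrite rx; exact: xb.
suff H : (forall u, u \in r -> level u < b) ->
    exists2 a, a < b & forall u, u \in r -> level u <= a.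
  by move=> /H[a ab ra]; exists a => // u; rewrite -rx; exact: ra.
move: (r) => s; elim: s => [|v s IHs] sb; first by exists a0.
have [|a ab sa] := IHs; first by move=> u us; apply: sb; rewrite inE us orbT.
exists (Order.max a (level v)); first by rewrite gt_max ab sb// mem_head.
move=> u; rewrite inE le_max => /orP[/eqP->|/sa->//]; first by rewrite lexx orbT.
Qed.

(* [below b] injects in the finite sequences over [rat * seg b]. *)
Lemma below_bound b (h : G -> W) : exists c, forall x, below b x -> h x < c.
Proof.
have [code codei codeP] := agroup_code K.
have [w0 _] : exists w0 : W, True by exists w.
pose dec (s : seq (rat * seg b)) : W :=
  if pselect (exists x : G, below b x /\
    [seq (c.1, level c.2) | c <- code x] = [seq (c.1, val c.2) | c <- s])
  is left e then h (projT1 (cid e)) else w0.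
have [c cP] := narrow_seq (narrow_prod (narrow_count (T := rat))
  (@narrow_seg b)) dec.
exists c => x xb.
have [s sP] : exists s : seq (rat * seg b),
    [seq (c.1, level c.2) | c <- code x] = [seq (c.1, val c.2) | c <- s].
  have : forall c, c \in code x -> level c.2 < b by move=> q /codeP/xb.
  elim: (code x) => [|q s IHs] sb; first by exists [::].
  have [|t tP] := IHs; first by move=> r rs; apply: sb; rewrite inE rs orbT.
  have qb : seg b (level q.2) by apply: sb; exact: mem_head.
  by exists ((q.1, SigSub (mem_set qb)) :: t); rewrite /= tP.
have := cP s; rewrite /dec; case: pselect => [e|[]]; last by exists x.
case: cid => y /= [yb]; rewrite -sP => /inj_map yx; suff -> : y = x by [].
apply/codei/yx => -[q u] [q' u'] [/= -> ?]; congr (_, _); exact: level_inj.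
Qed.

Lemma is_aleph_omega1_agroup : is_aleph_omega1 [set: G].
Proof.
have [_ W1 _] := Wom; have [WX XW] := omegaW_fun.
apply: is_aleph_omega1_injects W1 => //.
  by apply: injects_trans WX _; exists (@agen K); exact: agen_inj.
have [code codei _] := agroup_code K.
apply: injects_trans (injects_trans seq_fun_injects XW).
by exists code.
Qed.

(** * The contradiction at a closure point in [S] *)

Variables (S : set W) (C : W -> set W) (delta : W).
Notation F a := (range (f a)).
Notation E b := (\bigcup_(a in C b) F a).
Hypothesis Sstat : stationary S.
Hypothesis Scof : forall b, S b -> has_cofinality_aleph1 b.
Hypothesis Ccof : forall b, S b -> cofinal_in (C b) (seg b).
Hypothesis dcount : countable (seg delta).
Hypothesis Etype : forall b D, S b -> cofinal_in D (C b) ->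
  has_order_type (\bigcup_(a in D) F a) delta.
Hypothesis Edisj : forall b c, S b -> S c -> b <> c ->
  has_order_type_below (E b `&` E c) delta.
Hypothesis dind : indecomposable delta.

Lemma Etype_full b : S b -> has_order_type (E b) delta.
Proof. by move=> Sb; apply: (Etype Sb); split=> [//|c Cc]; exists c. Qed.

(* For fixed [a], the sets [E b `&` F a] that are not small are distinct subsets
   of the countable set [F a], so there are at most continuum many of them. *)
Lemma large_bound a : exists c, forall b, S b -> ~ small delta (E b `&` F a) -> b < c.
Proof.
pose h (A : beth 1) : W := if pselect (exists b, [/\ S b,
    ~ small delta (E b `&` F a) & A = [set n | E b (f a n)]]) is left e
  then projT1 (cid e) else w.
have [c cP] := narrow_beth h; exists c => b Sb nb.
have := cP [set n | E b (f a n)]; rewrite /h; case: pselect => [e|[]]; last by exists b.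
case: cid => b' /= [Sb' nb' bb'].
suff -> : b = b' by [].
apply: contrapT => /(Edisj Sb Sb')/small_below; apply: contra_not nb.
apply: small_sub => x [Ebx [n _ nx]]; split=> //.
have : [set n | E b (f a n)] n by rewrite /= nx.
by rewrite bb' /= nx.
Qed.

(** One bound serves all closure conditions on [b]; each concerns a family too small to be unbounded
    in [W]. Functions with values in [F a] have the form [fK a (s n)]. *)
Lemma closure_bound (wit : G -> nat -> G) a : exists m, forall c, m <= c ->
  [/\ forall (x : G) k, (forall u, (x u != 0)%R -> level u <= a) -> below c (wit x k),
      forall s : nat -> nat, level (fun n => fK a (s n)) < c
    & forall b, S b -> ~ small delta (E b `&` F a) -> b < c].
Proof.
have /boolp.choice[bd bdP] := below_ex.
have /boolp.choice[h hP] x : exists c, forall k, bd (wit x k) < c.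
  exact: (narrow_count (fun k => bd (wit x k))).
have [a' aa'] := no_max a; have [c1 c1P] := below_bound a' h.
have [c2 c2P] := narrow_nat_fun (fun s => level (fun n => fK a (s n))).
have [c3 c3P] := large_bound a.
exists (Order.max c1 (Order.max c2 c3)) => c; rewrite !ge_max => /and3P[c1c c2c c3c].
split=> [x k xa|s|b Sb nb].
- apply: (below_sub _ (bdP _)); apply: le_trans c1c; apply/ltW.
  apply: lt_trans (hP x k) (c1P x _) => u /xa /le_lt_trans; exact.
- exact: lt_le_trans (c2P s) c2c.
- exact: lt_le_trans (c3P b Sb nb) c3c.
Qed.

Lemma small_bigcup_seq (T : eqType) (r : seq T) (A : T -> set W) :
  small delta set0 -> (forall t, t \in r -> small delta (A t)) ->
  small delta (\bigcup_(t in [set` r]) A t).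
Proof.
move=> s0; elim: r => [|t r IHr] sA; first by apply: small_sub s0 => x [].
apply: small_sub (small_setU Wwo (indecomposableP Wwo dind) (sA t _) (IHr _)).
- move=> x [u /=]; rewrite inE => /orP[/eqP->|ur] Ax; first by left.
  by right; exists u.
- exact: mem_head.
- by move=> u ur; apply: sA; rewrite inE ur orbT.
Qed.

Lemma no_chain : ~ admits_aleph0_prebalanced_chain G.
Proof.
move=> /(chain_witnesses (@agroup_torsion_free K))[wit witP].
have /boolp.choice[m mP] := closure_bound wit.
have [Cl /Sstat[b [Sb Clb]] mb] := closure_club m.
have {Clb}mb := mb b Clb.
have [X [[Xb _] X1 cofmin]] := Scof Sb.
have [Cb Ccofb] := Ccof Sb.
have [x0 Xx0] : X !=set0.
  have [_ nX] := (is_alephP gch 1 X).1 X1; have [h _] := nX.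
  by exists (val (h set0)); exact: set_valP.
have [c0 Cc0 _] := Ccofb _ (Xb _ Xx0).
have Ec0 : E b (f c0 0%N) by exists c0.
have c0b : c0 < b := Cb _ Cc0.
have [u uP] : exists u : nat -> E b, forall x, E b x ->
    exists p : prime_number, val (u (val p)) = x.
  apply: countable_prime_enum; last by exists (f c0 0%N).
  have [phi [[phid phii _] _]] := Etype_full Sb.
  apply: card_le_trans dcount; apply/card_le_injects.
  exists (fun x => SigSub (mem_set (phid (val x) (set_valP x)))) => x y [].
  by move=> /phii xy; apply: val_inj; apply: xy; exact: (mem_set (set_valP _)).
have Ew x : E b x -> seg w x by move=> [a _ [n _ <-]]; exact: fw.
pose v n : K := SigSub (mem_set (Ew _ (set_valP (u n)))).
have [Om [Omc Omb Omcov]] : exists Om, witnesses (below b) (agen v) Om.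
  apply: witP; first exact: below_subgroup.
  move=> x k xb; have [a ab xa] := below_ltP c0b xb.
  have [wa _ _] := mP a (m a) (lexx _).
  exact: below_sub (ltW (mb a ab)) _ (wa x k xa).
have [om omP] : exists om : nat -> G, (forall n, below b (om n)) /\
    forall x, Om x -> exists n, om n = x.
  have [_ N2] := setT_injects nat.
  have /card_le_injects/injects_trans/(_ N2)[j ji] := Omc.
  have b0 : below b (0 : G)%R by apply: subgroup0; exact: below_subgroup.
  exists (fun n => if pselect (exists x : Om, j x = n) is left e
    then val (projT1 (cid e)) else 0%R); split=> [n|x Omx].
    case: pselect => [e|_]; last exact: b0.
    by apply: Omb; exact: set_valP.
  exists (j (SigSub (mem_set Omx))); case: pselect => [e|[]]; last first.
    by exists (SigSub (mem_set Omx)).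
  by case: cid => y /= /ji ->.
have [omb Omom] := omP.
have d0 : small delta set0.
  have [phi [[phid _ _] _]] := Etype_full Sb.
  exists (phi (f c0 0%N)); first exact: (phid _ Ec0).
  by exists id; split.
(* Otherwise [b] itself would be among the indices bounded by [m a], giving [b < b]. *)
have small_level a : a < b -> small delta (E b `&` F a).
  move=> /mb mab; apply: contrapT => na.
  by have [_ _ /(_ b Sb na)] := mP a b (ltW mab); rewrite ltxx.
(* [T x] contains the values of [v] at all primes where some [l v - x], with [l] positive, has
   infinite height. *)
pose T (x : G) : set W := \bigcup_(t in [set t | (x t != 0)%R]) (E b `&` F (level t)).
have smallT x : below b x -> small delta (T x).
  move=> xb; have [r rx] := agroup_support x.
  apply: (@small_sub _ _ _ _ (\bigcup_(t in [set` r]) (E b `&` F (level t)))).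
    by move=> z [t xt Ez]; exists t => //=; rewrite rx.
  by apply: small_bigcup_seq => // t; rewrite rx => /xb; exact: small_level.
pose Tn n := \bigcup_(i in [set` iota 0 n]) T (om i).
have smallTn n : small delta (Tn n).
  by apply: small_bigcup_seq => // i _; exact: smallT.
have coverC a : C b a -> exists n, F a `<=` Tn n.
  move=> Ca; have ab : a < b := Cb _ Ca.
  have /boolp.choice[s sP] n : exists i, F a (val (v n)) -> f a i = val (v n).
    have [[i _ fi]|nF] := pselect (F a (val (v n))); first by exists i.
    by exists 0%N.
  (* [z] has values in [F a] and agrees with [v] wherever [v] does, so [v - z] has infinite height
     at the corresponding primes. *)
  pose z n := fK a (s n).
  have zb : below b (agen z).
    apply: below_agen; have [_ + _] := mP a b (ltW (mb a ab)).
    exact.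
  have [B [Bfin BS] [P0 _ Bcov]] := Omcov 1%N (agen z) isT zb.
  have /boolp.choice[o oP] y : exists i, B y -> exists2 l, (0 < l)%N &
      y = (agen v *+ l - om i)%R.
    have [/BS[l [g [l0 /Omom[i <-] ->]]]|] := pselect (B y); last by exists 0%N.
    by exists i => _; exists l.
  (* The covering is finite, so it involves only witnesses [om i] with [i] below some [n]. *)
  have [n nP] : exists n, forall y, B y -> (o y < n)%N.
    have /finite_seqP[r Br] := Bfin; exists (\max_(y <- r) o y).+1 => y By.
    by rewrite ltnS; apply: leq_bigmax_seq => //; rewrite Br in By.
  exists n => _ [i _ <-].
  have [p pi] : exists p : prime_number, val (u (val p)) = f a i.
    by apply: uP; exists a => //; exists i.
  have vz : v (val p) = z (val p).
    apply: val_inj; rewrite /= [RHS]sP//=; rewrite pi; by exists i.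
  have dp k : ndivides (val p ^ k) (agen v *+ 1 - agen z)%R.
    by rewrite GRing.mulr1n; exact: agen_divisible.
  have [|y By yP] := Bcov p; first by right.
  have [l l0 yE] := oP y By.
  have [|t omt tp] := @agen_divisible_support _ p v l (om (o y)) l0.
    by move=> k; rewrite -yE; exact: yP.
  exists (o y); first by rewrite /= mem_iota add0n nP.
  exists t => //; split; first by exists a => //; exists i.
  exists (val p) => //; rewrite -pi.
  have := congr1 (fun x : K => val x) tp; rewrite -{1}(levelK t); exact.
pose D n := [set a | C b a /\ F a `<=` Tn n].
have [[n Dcof]|none] := pselect (exists n, cofinal_in (D n) (C b)).
  apply: (order_type_smallN Wwo (Etype Sb Dcof)); apply: small_sub (smallTn n).
  by move=> x [a [_ Fa] Fx]; exact: Fa.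
(* If no [D n] is cofinal, strict bounds [c n] in [C b] form a countable cofinal subset of [b],
   against cofinality aleph_1. *)
have /boolp.choice[c cP] n : exists c, C b c /\ forall a, D n a -> a < c.
  apply: contrapT => nc; apply: none; exists n; split=> [a []//|c Cc].
  apply: contrapT => na; apply: nc; exists c; split=> // a Da.
  by rewrite ltNge; apply/negP => ca; apply: na; exists a.
have /cofmin/card_le_injects Xc : cofinal_in (range c) (seg b).
  split=> [_ [n _ <-]|a /Ccofb[a' Ca' aa']]; first by have [/Cb] := cP n.
  have [n Fn] := coverC a' Ca'; exists (c n); first by exists n.
  by apply: le_trans aa' (ltW _); have [_] := cP n; apply.
have [_ bX] := (is_alephP gch 1 X).1 X1.
apply: (@cantor nat); apply: injects_trans bX (injects_trans Xc _).
have [_ N2] := setT_injects nat; apply: injects_trans N2.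
by apply/card_le_injects; exact: card_image_le.
Qed.

End Star.

Theorem theorem1p4 (gch : GCH) (star : property_star) :
  exists G : zmodType,
    [/\ @torsion_free G, is_aleph_omega1 [set: G]
      & ~ admits_aleph0_prebalanced_chain G].
Proof.
have [d [W [Wom [w [f [S [C [delta [wom [[fw fsurj] [[Sstat Scof]]]]]]]]]]]] := star.
move=> [Ccof [dcount [Etype [Edisj dind]]]].
exists (agroup (set_type (seg w))); split.
- exact: agroup_torsion_free.
- exact: is_aleph_omega1_agroup wom fw fsurj.
- apply: (no_chain gch Wom wom fw fsurj Sstat Scof _ dcount Etype Edisj dind).
  by move=> b /Ccof[].
Qed.
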